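(* Let $T>0$, $\beta>0$, $\rho\in[0,1)$, $A\in\mathbb R^{n_2\times n_2}$, $B\in\mathbb R^{n_2\times n}$, $L\in\mathbb R^{p_0\times n_2}$, $d\in\mathbb R^{p_0}$, $K\in\mathbb R^{n\times p_0}$, let $\phi_u:\mathbb R^n\to\mathbb R$ and $\phi_y:\mathbb R^{p_0}\to\mathbb R$ be continuously differentiable, and let $\mu$ be a probability distribution supported on $[0,T]$. For $\varepsilon>0$ consider the stochastic hybrid system $\mathcal H_\varepsilon$ with state $(x,z)$, $x=(u,p,\tau)\in\mathbb R^n\times\mathbb R^n\times[0,T]$, $z\in\mathbb R^{n_2}$: $$(x,z)\in C:\quad\dot u=p,\quad\dot p=-\beta p-\nabla\phi_u(u)-K\nabla\phi_y(Lz+d),\quad\dot\tau=1,\quad\varepsilon\dot z=Az+Bu,$$ $$(x,z)\in D:\quad u^+=u,\quad p^+\in\{sp:s\in[0,\rho]\},\quad\tau^+=v,\quad z^+=z,\qquad v\sim\mu,$$ where $C=\mathbb R^n\times\mathbb R^n\times[0,T]\times\mathbb R^{n_2}$ and $D=\mathbb R^n\times\mathbb R^n\times\{T\}\times\mathbb R^{n_2}$. Assume that: $A^\top P+PA\prec0$ for some positive definite matrix $P$; there exist $m_\phi,L_\phi,L_{\phi_y}>0$ such that, with $H:=-LA^{-1}B$, the function $\phi(u):=\phi_u(u)+\phi_y(Hu+d)$ is $L_\phi$-smooth and $m_\phi$-strongly convex, and $\phi_y$ is $L_{\phi_y}$-smooth; and there exists $T_e\in[0,T)$ such that $\mu([0,T_e])>0$.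 Let $u^\star$ be the unique minimizer of $\phi$ and let $\tilde{\mathcal A}:=\mathcal A\times\{-A^{-1}Bu^\star\}$ with $\mathcal A:=\{u^\star\}\times\{0\}\times[0,T]$. Then, with $K=H^\top$, there exists $\varepsilon^*\in(0,\infty)$ such that for all $\varepsilon\in(0,\varepsilon^* )$ the system $\mathcal H_\varepsilon$ renders the set $\tilde{\mathcal A}$ Uniformly Globally Asymptotically Stable in Probability (UGASp).
   Context: $M\prec0$ means that the symmetric matrix $M$ is negative definite (positive definite matrices are symmetric). A differentiable function is $\ell$-smooth if its gradient is $\ell$-Lipschitz. $|y|_S:=\inf_{s\in S}\|y-s\|$; $\mathbb B^\circ$ is the open unit ball. Random solutions. Write the system as: $y\in C$, $\dot y\in F_\varepsilon(y)$; $y\in D$, $y^+\in G(y,v)$, $v\sim\mu$, with $y=(x,z)$. The random input is an i.i.d. sequence $\mathbf v_k$, $k\ge1$, on a probability space $(\Omega,\mathcal F,\mathbb P)$ with distribution $\mu$. A hybrid time domain is a subset of $\mathbb R_{\ge0}\times\mathbb Z_{\ge0}$ that is a (finite or infinite) union of consecutive intervals $[t_j,t_{j+1}]\times\{j\}$, $0=t_0\le t_1\le\dots$, the last one (if any) possibly of the form $[t_j,\bar t)\times\{j\}$ with $\bar t\le\infty$; a hybrid arc is a function $\psi$ on a hybrid time domain $\mathrm{dom}(\psi)$ with $t\mapsto\psi(t,j)$ locally absolutely continuous for each $j$. Let $\mathcal F_0$ be trivial and $\mathcal F_\ell=\sigma(\mathbf v_1,\dots,\mathbf v_\ell)$. A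 stochastic hybrid arc is a map $\omega\mapsto\mathbf y_\omega$ to hybrid arcs such that $\omega\mapsto\mathrm{graph}(\mathbf y_\omega)=\{(t,j,s):(t,j)\in\mathrm{dom}(\mathbf y_\omega),s=\mathbf y_\omega(t,j)\}$ is $\mathcal F$-measurable with closed values; it is adapted if the restriction of this graph to $j\in\{0,\dots,\ell\}$ is $\mathcal F_\ell$-measurable in $\omega$ for each $\ell$. (A set-valued map $\Phi$ on $\Omega$ is $\mathcal F$-measurable if $\{\omega:\Phi(\omega)\cap O\ne\emptyset\}\in\mathcal F$ for every open $O$.) A random solution from $y_0$ is an adapted stochastic hybrid arc with $\mathbf y_\omega(0,0)=y_0$ such that: if $(t_1,j),(t_2,j)\in\mathrm{dom}(\mathbf y_\omega)$, $t_1<t_2$, then for almost all $t\in[t_1,t_2]$, $\mathbf y_\omega(t,j)\in C$ and $\dot{\mathbf y}_\omega(t,j)\in F_\varepsilon(\mathbf y_\omega(t,j))$; and if $(t,j),(t,j+1)\in\mathrm{dom}(\mathbf y_\omega)$, then $\mathbf y_\omega(t,j)\in D$ and $\mathbf y_\omega(t,j+1)\in G(\mathbf y_\omega(t,j),\mathbf v_{j+1}(\omega))$. It is maximal if it cannot be extended to a random solution whose sample paths are strictly longer with positive probability. UGASp of a compact set $\tilde{\mathcal A}$ means that all of the following hold, with $\varpi(y):=|y|_{\tilde{\mathcal A}}$ for $y\in C\cup D$. (C1) For each $\epsilon>0,\varrho>0$ there is $\delta>0$ such that every maximal random solution with $\varpi(\mathbf y_\omega(0,0))\le\delta$ satisfies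 $\mathbb P(\mathbf y_\omega(t,j)\in\tilde{\mathcal A}+\epsilon\mathbb B^\circ\ \forall(t,j)\in\mathrm{dom}(\mathbf y_\omega))\ge1-\varrho$. (C2) For each $\delta>0,\varrho>0$ there is $\epsilon>0$ such that the same inequality holds for every maximal random solution with $\varpi(\mathbf y_\omega(0,0))\le\delta$. (C3) For each $\epsilon,\varrho,R>0$ there is $\bar T\ge0$ such that every random solution with $\varpi(\mathbf y_\omega(0,0))\le R$ satisfies $\mathbb P(\mathbf y_\omega(t,j)\in\tilde{\mathcal A}+\epsilon\mathbb B^\circ\ \forall (t,j)\in\mathrm{dom}(\mathbf y_\omega)\text{ with }t+j\ge\bar T)\ge1-\varrho$. *)

(* Defs.v *)
From HB Require Import structures.
From mathcomp Require Export all_boot all_order all_algebra.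
From mathcomp Require Export all_classical all_reals all_analysis.
Export Order.TTheory GRing.Theory Num.Theory.
Export numFieldNormedType.Exports.

Set Implicit Arguments.
Unset Strict Implicit.
Unset Printing Implicit Defensive.

Local Open Scope classical_set_scope.
Local Open Scope ring_scope.

(* The norm carried by the matrix types of the library is the sup norm; it has
   the same topology and the same notion of differentiability, but Lipschitz
   constants, strong convexity and distances refer to the Euclidean norm. *)
Section euclidean.
Variables (R : realType) (n : nat).
Implicit Types (x y : 'cV[R]_n) (S : set 'cV[R]_n) (f : 'cV[R]_n -> R).

Definition enorm x : R := Num.sqrt (\sum_i x i 0 ^+ 2).

Definition edist S x : R := inf [set enorm (x - s) | s in S].

(* [S + e B], with [B] the open unit ball *)
Definition eball S (e : R) : set 'cV[R]_n :=
  [set x | exists2 s, S s & enorm (x - s) < e].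

Definition grad f x : 'cV[R]_n := \col_i 'D_(delta_mx i 0) f x.

Definition continuously_differentiable f : Prop :=
  (forall x, differentiable f x) /\ continuous (grad f).

Definition smooth (l : R) f : Prop :=
  (forall x, differentiable f x) /\
  (forall x y, enorm (grad f x - grad f y) <= l * enorm (x - y)).

Definition strongly_convex (m : R) f : Prop :=
  convex_function setT (fun x => f x - m / 2 * enorm x ^+ 2).

Definition unique_minimizer f x : Prop :=
  (forall y, f x <= f y) /\ (forall y, (forall z, f y <= f z) -> y = x).

Definition posdef (M : 'M[R]_n) : Prop :=
  M^T = M /\ forall x, x != 0 -> 0 < (x^T *m M *m x) 0 0.

Definition negdef (M : 'M[R]_n) : Prop :=
  M^T = M /\ forall x, x != 0 -> (x^T *m M *m x) 0 0 < 0.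

Definition absolutely_continuous (a b : R) (f : R -> 'cV[R]_n) : Prop :=
  forall e : R, 0 < e -> exists2 d : R, 0 < d &
    forall (k : nat) (l r : 'I_k -> R),
      (forall i, a <= l i /\ l i <= r i /\ r i <= b) ->
      trivIset setT (fun i => `]l i, r i[%classic) ->
      \sum_i (r i - l i) < d ->
      \sum_i enorm (f (r i) - f (l i)) < e.

End euclidean.

Section hybrid_arcs.
Variables (R : realType) (N : nat).

(* [ht_domain E]: the jump times are [s 0 = 0 <= s 1 <= ...]. Either there are
   infinitely many intervals, all of them [[s j, s j.+1]]; or the last one has
   index [k], and it is an arbitrary nonempty interval with left endpoint [s k]
   included: [[s k, b]], [[s k, b[] or [[s k, +oo[], according to [c]. *)
Definition ht_domain (E : set (R * nat)) : Prop :=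
  exists2 s : nat -> R,
    s 0%N = 0 /\ (forall j, s j <= s j.+1) &
    E = [set tj | s tj.2 <= tj.1 <= s tj.2.+1] \/
    exists (k : nat) (c : itv_bound R),
      s k \in Interval (BLeft (s k)) c /\
      E = [set tj | (tj.2 < k)%N /\ s tj.2 <= tj.1 <= s tj.2.+1] `|`
          [set tj | tj.2 = k /\ tj.1 \in Interval (BLeft (s k)) c].

(* The values of [hval] outside [hdom] are irrelevant. *)
Record arc := Arc { hdom : set (R * nat); hval : R -> nat -> 'cV[R]_N }.

Definition hgraph (y : arc) : set (R * nat * 'cV[R]_N) :=
  [set p | hdom y p.1 /\ p.2 = hval y p.1.1 p.1.2].

Definition hybrid_arc (y : arc) : Prop :=
  ht_domain (hdom y) /\
  forall (j : nat) (a b : R), a <= b -> hdom y (a, j) -> hdom y (b, j) ->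
    absolutely_continuous a b (hval y ^~ j).

Definition hextends (y y' : arc) : Prop := hgraph y `<=` hgraph y'.

End hybrid_arcs.

(* [y \in C, y' \in F y; y \in D, y+ \in G y v, v ~ mu] on R^N *)
Record shs (R : realType) (N : nat) := Shs {
  flow_set : set 'cV[R]_N;
  flow_map : 'cV[R]_N -> set 'cV[R]_N;
  jump_set : set 'cV[R]_N;
  jump_map : 'cV[R]_N -> R -> set 'cV[R]_N;
  input_law : probability (measurableTypeR R) R }.

(* Measurability of a set-valued map with respect to a family of events [S]. *)
Definition setmap_measurable (T : Type) (U : topologicalType) (S : set (set T))
    (Phi : T -> set U) : Prop :=
  forall O : set U, open O -> S [set w | Phi w `&` O !=set0].

Section random_solutions.
Variables (R : realType) (N : nat) (H : shs R N).
Variables (d : measure_display) (Omega : measurableType d).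
Variable P : probability Omega R.
(* [v j] is the (j+1)-th random input, the one used at the jump from [j] to
   [j.+1]. *)
Variable v : nat -> {RV P >-> measurableTypeR R}.
Implicit Types (y : Omega -> arc R N) (A : set 'cV[R]_N).

Definition iid_input : Prop :=
  (forall (j : nat) (B : set (measurableTypeR R)), measurable B ->
     distribution P (v j) B = input_law H B) /\
  (forall (J : seq nat) (B : nat -> set (measurableTypeR R)),
     uniq J -> (forall j, measurable (B j)) ->
     P (\big[setI/setT]_(j <- J) (v j @^-1` B j)) =
       (\prod_(j <- J) P (v j @^-1` B j))%E).

Definition input_filtration (l : nat) : set (set Omega) :=
  g_sigma_preimage (fun i : 'I_l => (v i : Omega -> measurableTypeR R)).

Definition stochastic_hybrid_arc y : Prop :=
  (forall w, hybrid_arc (y w)) /\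
  (forall w, closed (hgraph (y w))) /\
  setmap_measurable measurable (fun w => hgraph (y w)).

Definition adapted y : Prop :=
  forall l : nat, setmap_measurable (input_filtration l)
    (fun w => hgraph (y w) `&` [set p | (p.1.2 <= l)%N]).

Definition random_solution (y0 : 'cV[R]_N) y : Prop :=
  stochastic_hybrid_arc y /\ adapted y /\
  forall w,
    let Y := hval (y w) in let E := hdom (y w) in
    [/\ E (0, 0%N) /\ Y 0 0%N = y0,
        (forall (j : nat) (t1 t2 : R), E (t1, j) -> E (t2, j) -> t1 < t2 ->
           {ae @lebesgue_measure R, forall t, t \in `[t1, t2] ->
              flow_set H (Y t j) /\
              exists2 dy, flow_map H (Y t j) dy &
                is_derive (t : R) (1 : R) (Y ^~ j) dy}) &
        (forall (t : R) (j : nat), E (t, j) -> E (t, j.+1) ->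
           jump_set H (Y t j) /\ jump_map H (Y t j) (v j w) (Y t j.+1))].

Definition maximal_random_solution (y0 : 'cV[R]_N) y : Prop :=
  random_solution y0 y /\
  ~ exists y', [/\ random_solution y0 y',
                   forall w, hextends (y w) (y' w) &
                   (0 < P [set w | hdom (y w) <> hdom (y' w)])%E].

Definition initial_within A (r : R) (y0 : 'cV[R]_N) : Prop :=
  (flow_set H `|` jump_set H) y0 /\ edist A y0 <= r.

(* As the graphs are closed and depend measurably on [w], this set and the one
   in [maximal_random_solution] are events for every stochastic hybrid arc. *)
Definition stays_within A (e T : R) y : set Omega :=
  [set w | forall (t : R) (j : nat), hdom (y w) (t, j) -> T <= t + j%:R ->
     eball A e (hval (y w) t j)].

Definition ugasp_C1 A : Prop :=
  forall e r : R, 0 < e -> 0 < r -> exists2 delta : R, 0 < delta &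
    forall (y0 : 'cV[R]_N) y, initial_within A delta y0 -> maximal_random_solution y0 y ->
      ((1 - r)%:E <= P (stays_within A e 0 y))%E.

Definition ugasp_C2 A : Prop :=
  forall delta r : R, 0 < delta -> 0 < r -> exists2 e : R, 0 < e &
    forall (y0 : 'cV[R]_N) y, initial_within A delta y0 -> maximal_random_solution y0 y ->
      ((1 - r)%:E <= P (stays_within A e 0 y))%E.

Definition ugasp_C3 A : Prop :=
  forall e r rad : R, 0 < e -> 0 < r -> 0 < rad -> exists2 Tbar : R, 0 <= Tbar &
    forall (y0 : 'cV[R]_N) y, initial_within A rad y0 -> random_solution y0 y ->
      ((1 - r)%:E <= P (stays_within A e Tbar y))%E.

End random_solutions.

(* quantified over all realizations of the random input, so that it is a property
   of the system alone *)
Definition ugasp (R : realType) (N : nat) (H : shs R N) (A : set 'cV[R]_N) :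
    Prop :=
  forall (d : measure_display) (Omega : measurableType d)
    (P : probability Omega R) (v : nat -> {RV P >-> measurableTypeR R}),
  iid_input H v ->
  [/\ ugasp_C1 H v A, ugasp_C2 H v A & ugasp_C3 H v A].

Section interconnection.
Variables (R : realType) (n n2 p0 : nat).

Let N := (n + n + 1 + n2)%N.

(* the state [((u, p, tau), z)] as one column vector *)
Definition stack (u p : 'cV[R]_n) (tau : R) (z : 'cV[R]_n2) : 'cV[R]_N :=
  col_mx (col_mx (col_mx u p) (tau%:M : 'cV[R]_1)) z.

Definition u_of (y : 'cV[R]_N) : 'cV[R]_n := usubmx (usubmx (usubmx y)).
Definition p_of (y : 'cV[R]_N) : 'cV[R]_n := dsubmx (usubmx (usubmx y)).
Definition tau_of (y : 'cV[R]_N) : R := dsubmx (usubmx y) 0 0.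
Definition z_of (y : 'cV[R]_N) : 'cV[R]_n2 := dsubmx y.

Definition Hsys (T beta rho : R)
    (A : 'M[R]_n2) (B : 'M[R]_(n2, n)) (L : 'M[R]_(p0, n2)) (d : 'cV[R]_p0)
    (K : 'M[R]_(n, p0)) (phi_u : 'cV[R]_n -> R) (phi_y : 'cV[R]_p0 -> R)
    (mu : probability (measurableTypeR R) R) (eps : R) : shs R N :=
  {| flow_set := [set y | 0 <= tau_of y <= T];
     flow_map := fun y =>
       let u := u_of y in let p := p_of y in let z := z_of y in
       [set stack p
              (- (beta *: p) - grad phi_u u - K *m grad phi_y (L *m z + d))
              1
              (eps^-1 *: (A *m z + B *m u))];
     jump_set := [set y | tau_of y = T];
     jump_map := fun y v =>
       [set stack (u_of y) (s *: p_of y) v (z_of y) | s in `[0, rho]];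
     input_law := mu |}.

(* [A] is invertible whenever the Lyapunov inequality of the theorem holds, in
   which case [invmx A] is its inverse. *)
Definition Hss (A : 'M[R]_n2) (B : 'M[R]_(n2, n)) (L : 'M[R]_(p0, n2)) :
    'M[R]_(p0, n) := - (L *m invmx A *m B).

(* [{u*} x {0} x [0, T] x {- A^-1 B u*}] *)
Definition target_set (T : R) (A : 'M[R]_n2) (B : 'M[R]_(n2, n))
    (ustar : 'cV[R]_n) : set 'cV[R]_N :=
  [set stack ustar 0 tau (- (invmx A *m B *m ustar)) | tau in `[0, T]].

End interconnection.

(* Main.v *)
Require Import Defs.
From mathcomp Require Import measurable_realfun.
From mathcomp Require Import ring lra.

(** Write [zdev = z + A^-1 B u] for the deviation of the fast state from its
    steady state. The Lyapunov function is the energy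
      [V = phi u - phi ustar + |p|^2 / 2 + zdev^T P zdev],
    which strong convexity and smoothness of [phi] make comparable with the
    squared distance to the target ([energy_bounds]).

    During flows the slow part dissipates [beta |p|^2] and the fast part
    dissipates a multiple of [eps^-1 |zdev|^2]. The choice [K = H^T] turns the
    force on [p] into [- grad phi u] plus an error which is Lipschitz in
    [zdev], so for small [eps] the two dissipations absorb every coupling term
    and [V' <= - (beta / 2) |p|^2 - |zdev|^2] ([energy_rates]). At jumps [u] and
    [z] are kept and [p] shrinks. Hence [V] never increases, and the two
    stability bounds hold surely on the event, of probability one, that all
    resets of the timer fall into [0, T].

    For attractivity the dissipation lacks a term in [u - ustar]. The usual
    remedy adds a small multiple of [p . (u - ustar)] to [V], but that term may
    increase at jumps. It is therefore weighted by a function of time which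
    vanishes at both ends of a window of length [h], which yields
    [V (end) <= kappa V (start)], with [kappa < 1], for each flow of duration at
    least [h] ([interval_contraction], [flow_decay]). A reset [v <= Te] forces
    the next flow to last [T - v >= h := T - Te] before the timer allows a jump.
    As such resets are independent with positive probability, [M] disjoint
    blocks of [b] resets each contain one of them, except with probability at
    most [M (1 - mu [0, Te])^b] ([many_low_resets]). Since a flow lasts at most
    [T], large hybrid times come after many jumps, hence after [M] contractions
    ([hybrid_decay], [solution_decay]).

    Two analytic points support this. Solutions satisfy the differential
    equation only almost everywhere; an absolutely continuous function whose
    derivative is at most [c] almost everywhere grows at rate at most [c]
    ([ac_derive_le]), and as the field is continuous this makes the flows
    differentiable at every interior time ([ac_flow_C1]), so that ordinary
    calculus applies. And a probability is bounded below by monotonicity only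
    once the event is known to be measurable: the graphs are closed and
    measurable with respect to open sets, and closed subsets of a Euclidean
    space are countable unions of compact sets ([stays_within_measurable]). *)

Set Implicit Arguments.
Unset Strict Implicit.
Unset Printing Implicit Defensive.

Local Open Scope classical_set_scope.
Local Open Scope ring_scope.

(** * Absolutely continuous functions with a bound on the derivative almost everywhere *)

Section ac.
Variable R : realType.
Implicit Types (f : R -> R) (a b c t : R).

(** [absolutely_continuous] for real functions, with the absolute value in the
    place of the Euclidean norm. *)
Definition ac_real a b f : Prop :=
  forall e : R, 0 < e -> exists2 d : R, 0 < d &
    forall (k : nat) (l r : 'I_k -> R),
      (forall i, a <= l i /\ l i <= r i /\ r i <= b) ->
      trivIset setT (fun i => `]l i, r i[%classic) ->
      \sum_i (r i - l i) < d ->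
      \sum_i `|f (r i) - f (l i)| < e.

(** Intervals are collected one at a time in [ac_derive_le], for which lists of
    endpoints ordered from right to left are more convenient than families
    indexed by ['I_k]. *)
Lemma ac_real_seq a b f (s : seq (R * R)) (d e : R) :
  (forall (k : nat) (l r : 'I_k -> R),
      (forall i, a <= l i /\ l i <= r i /\ r i <= b) ->
      trivIset setT (fun i => `]l i, r i[%classic) ->
      \sum_i (r i - l i) < d ->
      \sum_i `|f (r i) - f (l i)| < e) ->
  all (fun p => [&& a <= p.1, p.1 <= p.2 & p.2 <= b]) s ->
  pairwise (fun p q => q.2 <= p.1) s ->
  \sum_(p <- s) (p.2 - p.1) < d ->
  \sum_(p <- s) `|f p.2 - f p.1| < e.
Proof.
move=> fac /allP sab spw sd.
have E (F : R * R -> R) : \sum_(p <- s) F p =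
    \sum_(i < size s) F (nth (0, 0) s i) by rewrite (big_nth (0, 0)) big_mkord.
rewrite E; apply: (fac (size s) (fun i => (nth (0, 0) s i).1)
  (fun i => (nth (0, 0) s i).2)).
- move=> i; have /and3P[] := sab _ (mem_nth (0, 0) (ltn_ord i)).
  by [].
- apply/trivIsetP => i j _ _ ij.
  have key (p q : 'I_(size s)) : (p < q)%N ->
      (nth (0, 0) s q).2 <= (nth (0, 0) s p).1.
    by move=> pq; move/(pairwiseP (0, 0)): spw; apply => //; rewrite inE.
  rewrite -subset0 => x /= []; rewrite !in_itv/= => /andP[li ri] /andP[lj rj].
  move: ij; rewrite -val_eqE neq_lt => /orP[] /key h.
    by move: (lt_le_trans rj h) li => /lt_trans h1 /h1; rewrite ltxx.
  by move: (lt_le_trans ri h) lj => /lt_trans h1 /h1; rewrite ltxx.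
- by rewrite -(E (fun p => p.2 - p.1)).
Qed.

(** Outer regularity of the Lebesgue measure. *)
Lemma null_open_cover (Z : set R) (d : R) : 0 < d ->
  (@lebesgue_measure R).-negligible Z ->
  exists U : set R, [/\ open U, Z `<=` U & (lebesgue_measure U < d%:E)%E].
Proof.
move=> d0 [A [mA A0 ZA]].
have [|U [oU AU mU]] := @lebesgue_regularity_outer R A d mA _ d0.
  by rewrite [X in (X < _)%E]A0 ltry.
exists U; split => //; first exact: subset_trans AU.
have mUm : measurable U by exact: open_measurable.
have -> : U = A `|` (U `\` A) by rewrite setDUK.
rewrite measureU//; last by rewrite setDIK.
- by rewrite [X in (X + _ < _)%E]A0 add0e.
- exact: measurableD.
Qed.

(** The difference quotient is controlled for [r <= t <= s], not only for [r = t]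
    or [s = t], because the increments before and after [t] add up. *)
Lemma derive_upper_gauge f t df c : is_derive t (1 : R) f df -> df < c ->
  exists2 rho : R, 0 < rho & forall r s, t - rho < r -> r <= t -> t <= s ->
    s < t + rho -> f s - f r <= c * (s - r).
Proof.
move=> fd dfc.
have : (fun h : R => h^-1 *: (f (h + t) - f t)) @ 0^' --> df.
  have [fdt <-] := fd.
  have := fdt; rewrite /derivable => /cvg_ex[l hl].
  have := hl; rewrite /derive => /cvg_lim ->//.
  apply: cvg_trans hl; apply: near_eq_cvg; near=> h.
  by rewrite /= /GRing.scale/= mulr1.
move=> /cvgr_lt /(_ c dfc) [rho /= rho0 H].
have {}H h : h != 0 -> `|h| < rho -> h^-1 * (f (h + t) - f t) < c.
  by move=> h0 hr; apply: H => //=; rewrite sub0r normrN.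
exists rho => // r s tr rt ts sr.
have fs : f s - f t <= c * (s - t).
  have [->|st] := eqVneq s t; first by rewrite !subrr mulr0.
  have st0 : 0 < s - t by rewrite subr_gt0 lt_neqAle eq_sym st.
  have := H (s - t); rewrite gt_eqF// subrK gtr0_norm// => /(_ isT).
  rewrite ltrBlDl => /(_ sr).
  by rewrite mulrC ltr_pdivrMr// => /ltW.
have fr : f t - f r <= c * (t - r).
  have [->|rtn] := eqVneq r t; first by rewrite !subrr mulr0.
  have st0 : r - t < 0 by rewrite subr_lt0 lt_neqAle rtn.
  have := H (r - t); rewrite lt_eqF// subrK ltr0_norm// => /(_ isT).
  rewrite opprB => h; have {h} : (r - t)^-1 * (f r - f t) < c by apply: h; lra.
  by rewrite mulrC ltr_ndivrMr// => /ltW; lra.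
by lra.
Unshelve. all: by end_near. Qed.

(** The fundamental theorem of calculus in the form of an inequality, proved
    without integrals nor Vitali coverings. Let [U] be an open set of small measure
    that covers the exceptional null set. Every point [x] has a neighbourhood in
    which an interval [[r, s]] around [x] either satisfies
    [f s - f r <= (c + eta) (s - r)], or is contained in [U]. By the supremum
    argument on [S], finitely many such intervals lead from [a] to [b]; those in
    [U] have a small total length, so absolute continuity makes their
    contribution small. *)
Lemma ac_derive_le a b f c : a <= b -> ac_real a b f ->
  {ae @lebesgue_measure R, forall t, t \in `[a, b] ->
     exists2 df, is_derive (t : R) (1 : R) f df & df <= c} ->
  f b - f a <= c * (b - a).
Proof.
move=> ab fac fd.
suff H (eta : R) : 0 < eta <= 1 -> f b - f a <= c * (b - a) + eta * (b - a + 2).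
  rewrite leNgt; apply/negP => lt.
  set D := f b - f a - c * (b - a); have D0 : 0 < D by rewrite /D; lra.
  pose eta := Num.min 1 (D / (b - a + 2) / 2).
  have ba : 0 < b - a + 2 by lra.
  have e1 : eta <= 1 by rewrite /eta ge_min lexx.
  have e0 : 0 < eta.
    by rewrite /eta lt_min ltr01/= divr_gt0// divr_gt0.
  have e2 : eta * (b - a + 2) <= D / 2.
    have : eta <= D / (b - a + 2) / 2 by rewrite /eta ge_min lexx orbT.
    rewrite -(ler_pM2r ba); suff -> : D / (b - a + 2) / 2 * (b - a + 2) = D / 2 by [].
    by field; rewrite gt_eqF.
  have := H eta; rewrite e0 e1 => /(_ isT).
  by move: e2; rewrite /D; lra.
move=> /andP[eta0 eta1].
have [d d0 hd] := fac eta eta0.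
(* The second bound controls the terms [(c + eta) (r - l)] of the intervals in [U]. *)
pose d' := Num.min d (eta / (`|c| + 1)).
have c1 : 0 < `|c| + 1 by rewrite ltr_pwDr.
have d'0 : 0 < d' by rewrite /d' lt_min d0/= divr_gt0.
have d'd : d' <= d by rewrite /d' ge_min lexx.
have d'c : (`|c| + 1) * d' <= eta.
  have : d' <= eta / (`|c| + 1) by rewrite /d' ge_min lexx orbT.
  by rewrite ler_pdivlMr// mulrC.
have [U [oU ZU mU]] := null_open_cover d'0 fd.
(* The points that are reached from [a], with the intervals used in [U]. *)
pose S := [set x | a <= x <= b /\ exists s : seq (R * R),
  [/\ all (fun p => [&& a <= p.1, p.1 <= p.2 & p.2 <= x]) s,
      pairwise (fun p q => q.2 <= p.1) s,
      ((\sum_(p <- s) (p.2 - p.1))%:E <= lebesgue_measure (U `&` `]-oo, x[))%E &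
      f x - f a <= (c + eta) * (x - a) +
        \sum_(p <- s) (f p.2 - f p.1 - (c + eta) * (p.2 - p.1))]].
have gauge x : a <= x <= b -> exists2 rho : R, 0 < rho &
    forall r s, x - rho < r -> r <= x -> x <= s -> s < x + rho ->
     f s - f r <= (c + eta) * (s - r) \/ `]r, s[ `<=` U.
  move=> xab; have [xU|xU] := pselect (U x).
    have [rho /= rho0 H] : nbhs x U by exact: open_nbhs_nbhs.
    exists rho => // r s r1 r2 s1 s2; right => z /=; rewrite in_itv/= => /andP[rz zs].
    by apply: H; rewrite /ball/= ltr_distlC; clear -rz zs r1 r2 s1 s2;
      apply/andP; split; lra.
  have : ~ ~ (exists2 df, is_derive (x : R) (1 : R) f df & df <= c).
    move=> h; apply: xU; apply: ZU => /=; apply: contra_not h; apply.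
    by rewrite in_itv.
  move=> /contrapT [df dfx dfc].
  have [|rho rho0 H] := @derive_upper_gauge f x df (c + eta) dfx; first lra.
  by exists rho => // r s *; left; exact: H.
have Sa : S a.
  split; first by rewrite lexx ab.
  by exists [::]; split => //=; rewrite big_nil ?measure_ge0//; lra.
have supS : has_sup S by split; [exists a | exists b => x [/andP[]]].
have mab : a <= sup S <= b.
  rewrite (ub_le_sup _ Sa)/=; last by exact: supS.2.
  by apply: ge_sup; [exact: supS.1 | move=> x [/andP[]]].
have [rho rho0 G] := gauge _ mab.
have [y Sy ym] := sup_adherent rho0 supS.
have ymle : y <= sup S by apply: ub_le_sup => //; exact: supS.2.
pose x := Num.min b (sup S + rho / 2).
have mx : sup S <= x.
  by rewrite /x le_min (andP mab).2/= lerDl ltW// divr_gt0.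
have xm : x < sup S + rho.
  by rewrite /x gt_min; apply/orP; right; lra.
have xb : x <= b by rewrite /x ge_min lexx.
have yx : y <= x := le_trans ymle mx.
have ax : a <= x by apply: le_trans mx; case/andP: mab.
have mUI z : measurable (U `&` `]-oo, z[).
  by apply: measurableI => //; exact: open_measurable.
have Sx : S x.
  split; first by rewrite ax xb.
  case: Sy => /andP[ay yb] [s [s1 s2 s3 s4]].
  case: (G y x ym ymle mx xm) => [fyx|yxU].
    exists s; split => //.
    - apply: sub_all s1 => p /and3P[-> -> /= py]; exact: le_trans yx.
    - apply: le_trans s3 _; apply: le_measure; rewrite ?inE//; try exact: mUI.
      by move=> z [Uz] /=; rewrite !in_itv/= => zy; split => //; exact: lt_le_trans yx.
    - by clear -s4 fyx; lra.
  exists ((y, x) :: s); split => //=.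
  - rewrite ay yx lexx/=.
    apply: sub_all s1 => p /and3P[-> -> /= py]; exact: le_trans yx.
  - rewrite s2 andbT; apply: sub_all s1 => p /and3P[//].
  - rewrite big_cons/= EFinD.
    have -> : (x - y)%:E = lebesgue_measure (`]y, x[%classic : set R).
      rewrite lebesgue_measure_itv/= lte_fin; case: ltgtP yx => // ->.
      by rewrite subrr.
    have dis : `]y, x[%classic `&` (U `&` `]-oo, y[) = set0.
      rewrite -subset0 => z [] /=; rewrite !in_itv/= => /andP[yz _] [_ zy].
      by move: (lt_trans yz zy); rewrite ltxx.
    apply: (@le_trans _ _ (lebesgue_measure (`]y, x[%classic : set R) +
      lebesgue_measure (U `&` `]-oo, y[))%E).
      by rewrite leeD2l.
    rewrite -measureU//; last exact: mUI.
    apply: le_measure; rewrite ?inE//; try exact: mUI.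
      by apply: measurableU => //; exact: mUI.
    move=> z [|] /=; rewrite in_itv/=; last first.
      move=> [Uz]; rewrite !in_itv/= => zy; split => //; exact: lt_le_trans yx.
    move=> /andP[yz zx]; split; last by rewrite in_itv.
    by apply: yxU; rewrite /= in_itv/= yz zx.
  - by rewrite big_cons/=; clear -s4; lra.
have xE : x = b.
  have := ub_le_sup supS.2 Sx; rewrite /x minElt; case: ifP => // _; lra.
move: Sx; rewrite xE => -[_ [s [s1 s2 s3 s4]]].
have sd' : \sum_(p <- s) (p.2 - p.1) < d'.
  rewrite -lte_fin; apply: le_lt_trans s3 _; apply: le_lt_trans mU.
  apply: le_measure; rewrite ?inE//; [exact: mUI|exact: open_measurable].
have hs := ac_real_seq hd s1 s2 (lt_le_trans sd' d'd).
have sum0 : 0 <= \sum_(p <- s) (p.2 - p.1).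
  rewrite big_seq; apply: sumr_ge0 => p ps.
  by rewrite subr_ge0; move/allP: s1 => /(_ _ ps) /and3P[].
move: s4; rewrite sumrB -mulr_sumr => s4.
have h1 : \sum_(p <- s) (f p.2 - f p.1) <= eta.
  by apply: ltW; apply: le_lt_trans hs; apply: ler_sum => p _; exact: ler_norm.
have h2 : - ((c + eta) * \sum_(p <- s) (p.2 - p.1)) <= eta.
  apply: le_trans d'c; apply: (@le_trans _ _ ((`|c| + 1) * \sum_(p <- s) (p.2 - p.1))).
    by rewrite -mulNr ler_wpM2r//; have := ler_norm (- c); rewrite normrN; clear -eta0; lra.
  by rewrite ler_wpM2l// ltW.
by clear -s4 h1 h2; lra.
Qed.

End ac.

(** * Absolutely continuous solutions of continuous differential equations *)

Section ac_flow.
Variable R : realType.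
Implicit Types (f g : R -> R) (a b c t : R).

Lemma ae_lebesgueS (P Q : R -> Prop) : (forall t, P t -> Q t) ->
  {ae @lebesgue_measure R, forall t, P t} -> {ae @lebesgue_measure R, forall t, Q t}.
Proof. by move=> PQ; apply: negligibleS => t /=; apply: contra_not; exact: PQ. Qed.

Lemma ac_real_sub a b a' b' f : a <= a' -> b' <= b ->
  ac_real a b f -> ac_real a' b' f.
Proof.
move=> aa bb fac e e0; have [d d0 H] := fac e e0; exists d => // k l r lr.
apply: H => i; have [? [? ?]] := lr i.
by split; [exact: le_trans aa _|split => //; exact: le_trans bb].
Qed.

Lemma ac_realN a b f : ac_real a b f -> ac_real a b (- f).
Proof.
move=> fac e e0; have [d d0 H] := fac e e0; exists d => // k l r *.
under eq_bigr do rewrite /= -opprD normrN.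
exact: H.
Qed.

(** Near [t] the derivative is almost everywhere within [eta] of [g t], and
    [ac_derive_le] applies to [f] and to [- f] between [s] and [t]. *)
Lemma ac_is_derive_bound a b f g t (eta : R) : a < t < b -> ac_real a b f ->
  {ae @lebesgue_measure R, forall t, t \in `[a, b] -> is_derive (t : R) (1 : R) f (g t)} ->
  {for t, continuous g} -> 0 < eta ->
  \forall s \near t, `|f s - f t - g t * (s - t)| <= eta * `|s - t|.
Proof.
move=> /andP[at_ tb] fac fd gc eta0.
have : \forall s \near t, `|g t - g s| <= eta.
  by move/cvgrPdist_le : gc; apply.
move=> [rho /= rho0 G].
have {}G s : `|t - s| < rho -> g t - eta <= g s <= g t + eta.
  by move=> /G /=; rewrite ler_distlC => /andP[h1 h2]; apply/andP; split; lra.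
have main r s : a <= r -> r <= s -> s <= b -> t - rho < r -> s < t + rho ->
    f s - f r <= (g t + eta) * (s - r) /\ (g t - eta) * (s - r) <= f s - f r.
  move=> ar rs sb tr st; split.
    apply: ac_derive_le => //; first exact: ac_real_sub fac.
    apply: ae_lebesgueS fd => x /= H; rewrite in_itv/= => /andP[rx xs].
    exists (g x); first by apply: H; rewrite in_itv/=; apply/andP; split; lra.
    by have := G x; rewrite ltr_distlC => /(_ ltac:(apply/andP; split; lra)) /andP[].
  have : (- f) s - (- f) r <= (- g t + eta) * (s - r); last by rewrite !fctE; lra.
  apply: ac_derive_le => //; first by apply: ac_realN; exact: ac_real_sub fac.
  apply: ae_lebesgueS fd => x /= H; rewrite in_itv/= => /andP[rx xs].
  exists (- g x).
    apply: is_deriveN; apply: H; rewrite in_itv/=; apply/andP; split; lra.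
  have := G x; rewrite ltr_distlC => /(_ ltac:(apply/andP; split; lra)) /andP[]; lra.
pose r0 := Num.min rho (Num.min (t - a) (b - t)).
have r00 : 0 < r0 by rewrite /r0 !lt_min rho0/= !subr_gt0 at_ tb.
exists r0 => //= s sr; have : `|t - s| < r0 := sr; rewrite /r0 !lt_min => /andP[h1 /andP[h2 h3]].
have [ts|st] := leP t s.
  rewrite ler0_norm in h1 h2 h3; last by rewrite subr_le0.
  have [| | | | |U L] := main t s; rewrite ?lexx//; try lra.
  rewrite (ger0_norm (_ : 0 <= s - t)) ?subr_ge0// ler_norml; apply/andP; split; lra.
rewrite gtr0_norm in h1 h2 h3; last by rewrite subr_gt0.
have [| | | | |U L] := main s t; rewrite ?lexx//; try lra.
rewrite (ltr0_norm (_ : s - t < 0)) ?subr_lt0// ler_norml; apply/andP; split; lra.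
Qed.

Lemma is_derive_near_bound f t (df : R) :
  (forall eta, 0 < eta -> \forall s \near t, `|f s - f t - df * (s - t)| <= eta * `|s - t|) ->
  is_derive t (1 : R) f df.
Proof.
move=> H.
suff C : (fun h : R => h^-1 *: ((f \o shift t) (h *: 1) - f t)) @ 0^' --> df.
  by apply: DeriveDef; [apply/cvg_ex; exists df | apply: cvg_lim].
apply/cvgrPdist_le => eta eta0.
have [rho /= rho0 G] := H _ eta0.
exists rho => //= h hr h0.
have {}hr : `|t - (h + t)| < rho.
  by move: hr; rewrite opprD addrCA subrr addr0 /= sub0r.
have := G (h + t) hr; rewrite /=.
rewrite addrK /GRing.scale/= mulr1 => G'.
have hn : 0 < `|h| by rewrite normr_gt0.
have -> : df - h^-1 * (f (h + t) - f t) = - (h^-1 * (f (h + t) - f t - df * h)).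
  by field.
by rewrite normrN normrM normfV ler_pdivrMl// [leRHS]mulrC.
Qed.

Lemma ac_is_derive a b f g t : a < t < b -> ac_real a b f ->
  {ae @lebesgue_measure R, forall t, t \in `[a, b] -> is_derive (t : R) (1 : R) f (g t)} ->
  {for t, continuous g} -> is_derive t (1 : R) f (g t).
Proof.
move=> atb fac fd gc; apply: is_derive_near_bound => eta eta0.
exact: (ac_is_derive_bound atb fac fd gc eta0).
Qed.

(** Precomposing with [clamp a b] extends a function on [[a, b]] to the whole line,
    so that continuity statements need no restriction to a subspace. *)
Definition clamp a b t : R := Num.max a (Num.min b t).

Lemma clamp_in a b t : a <= b -> a <= clamp a b t <= b.
Proof.
by move=> ab; rewrite /clamp le_max lexx/= ge_max ab ge_min lexx.
Qed.

Lemma clampE a b t : a <= t <= b -> clamp a b t = t.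
Proof. by move=> /andP[a_ b_]; rewrite /clamp min_r// max_r. Qed.

Lemma clamp_dist a b s t : `|clamp a b s - clamp a b t| <= `|s - t|.
Proof.
have maxd x y : `|Num.max a x - Num.max a y| <= `|x - y|.
  by case: (leP a x) => ?; case: (leP a y) => ?; rewrite ler_norml;
    case: (ger0P (x - y)) => ?; apply/andP; split; lra.
apply: le_trans (maxd _ _) _.
by case: (leP b s) => ?; case: (leP b t) => ?; rewrite ler_norml;
  case: (ger0P (s - t)) => ?; apply/andP; split; lra.
Qed.

Lemma enorm_coord n (x : 'cV[R]_n) i : `|x i 0| <= enorm x.
Proof.
rewrite /enorm -sqrtr_sqr ler_wsqrtr// (bigD1 i)//= lerDl.
by apply: sumr_ge0 => j _; exact: sqr_ge0.
Qed.

Lemma absolutely_continuous_coord n a b (Y : R -> 'cV[R]_n) i :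
  absolutely_continuous a b Y -> ac_real a b (fun t => Y t i 0).
Proof.
move=> Yac e e0; have [d d0 H] := Yac e e0; exists d => // k l r lr tr sd.
apply: le_lt_trans (H k l r lr tr sd); apply: ler_sum => j _.
by apply: le_trans (enorm_coord _ i); rewrite !mxE.
Qed.

Lemma ac_real_ucont a b f e : ac_real a b f -> 0 < e ->
  exists2 d : R, 0 < d & forall s t, a <= s -> s <= t -> t <= b -> t - s < d ->
   `|f t - f s| < e.
Proof.
move=> fac e0; have [d d0 H] := fac e e0; exists d => // s t as_ st tb tsd.
have := H 1%N (fun=> s) (fun=> t); rewrite !big_ord1; apply => //.
apply/trivIsetP => i j _ _; by rewrite !ord1 eqxx.
Qed.

Lemma ac_clamp_continuous a b f : a <= b -> ac_real a b f ->
  continuous (fun t => f (clamp a b t)).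
Proof.
move=> ab fac t; apply/cvgrPdist_lt => e e0.
have [d d0 H] := ac_real_ucont fac e0.
exists d => //= s ts.
have := clamp_dist a b t s; move=> /le_lt_trans /(_ ts).
have /andP[h1 h2] := clamp_in s ab; have /andP[h3 h4] := clamp_in t ab.
have [h|h] := leP (clamp a b s) (clamp a b t).
  by rewrite ger0_norm ?subr_ge0// => ?; exact: H.
by rewrite ltr0_norm ?subr_lt0// opprB distrC => ?; apply: H => //; exact: ltW.
Qed.

Lemma mx_continuous (T : topologicalType) n (Y : T -> 'cV[R]_n) (t : T) :
  (forall i, {for t, continuous (fun x : T => Y x i 0)}) -> {for t, continuous Y}.
Proof.
move=> H; apply/cvgrPdist_lt => e e0.
have : \forall s \near t, forall i, `|Y t i 0 - Y s i 0| < e.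
  apply: filter_forall => i; have /cvgrPdist_lt := H i; exact.
apply: filterS => s Hs.
rewrite [ltLHS]mx_normrE; apply/bigmax_ltP; split => // -[i j] _ /=.
by rewrite !mxE ord1; exact: Hs.
Qed.

Lemma is_derive_mxP n (Y : R -> 'cV[R]_n) t (dY : 'cV[R]_n) :
  is_derive t (1 : R) Y dY <-> forall i, is_derive t (1 : R) (fun t => Y t i 0) (dY i 0).
Proof.
split=> [[Yd <-] i|H].
  have /derivable_mxP Yd' := Yd.
  by apply: DeriveDef; [exact: Yd'|rewrite derive_mx// mxE].
have Yd : derivable Y t 1 by apply/derivable_mxP => i j; rewrite ord1; case: (H i).
apply: DeriveDef => //; rewrite derive_mx//; apply/matrixP => i j.
by rewrite mxE ord1; case: (H i).
Qed.

(** The derivative is prescribed almost everywhere by a continuous function of the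
    state, hence it exists and has that value at every interior time. *)
Lemma ac_flow_C1 n a b (Y : R -> 'cV[R]_n) (F : 'cV[R]_n -> 'cV[R]_n) : a <= b ->
  absolutely_continuous a b Y -> continuous F ->
  {ae @lebesgue_measure R, forall t, t \in `[a, b] -> is_derive (t : R) (1 : R) Y (F (Y t))} ->
  exists Z : R -> 'cV[R]_n, [/\ continuous Z,
    forall t, a <= t <= b -> Z t = Y t &
    forall t, a < t < b -> is_derive t (1 : R) Z (F (Z t))].
Proof.
move=> ab Yac Fc Yd.
have Zc : continuous (fun t => Y (clamp a b t)).
  move=> t; apply: mx_continuous => i.
  exact: (ac_clamp_continuous ab (absolutely_continuous_coord i Yac)).
exists (fun t => Y (clamp a b t)); split => //.
  by move=> t tab; rewrite clampE.
move=> t /[dup] tab /andP[at_ tb].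
suff : is_derive t (1 : R) Y (F (Y t)).
  rewrite clampE ?(ltW at_) ?(ltW tb)//.
  apply: near_eq_is_derive.
  near=> s; rewrite clampE//; apply/andP; split; apply: ltW; near: s.
    exact: lt_nbhsr.
  exact: lt_nbhsl.
apply/is_derive_mxP => i.
have -> : F (Y t) i 0 = F (Y (clamp a b t)) i 0.
  by rewrite clampE ?(ltW at_) ?(ltW tb).
apply: (@ac_is_derive a b _ (fun t => F (Y (clamp a b t)) i 0)) => //.
- exact: absolutely_continuous_coord.
- apply: ae_lebesgueS Yd => s /= H /[dup] /H /is_derive_mxP /(_ i) {}H.
  by rewrite in_itv/= => sab; rewrite clampE.
- have : {for t, continuous (F \o (fun t => Y (clamp a b t)))}.
    by apply: continuous_comp; [exact: Zc|exact: Fc].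
  move=> FZ; apply: (@continuous_comp _ _ _ (F \o (fun t => Y (clamp a b t)))
   (fun M : 'cV[R]_n => M i 0)) => //; exact: coord_continuous.
Unshelve. all: by end_near. Qed.

End ac_flow.

(** * Compactness, and measurability of the event of staying near a set *)

Section compactness.
Variable R : realType.

(** Tychonoff for row vectors, transported by transposition. *)
Lemma cV_box_compact n (M : R) :
  compact [set v : 'cV[R]_n | forall i, v i 0 \in `[- M, M]].
Proof.
have C := @rV_compact R n (fun=> `[- M, M]%classic)
  (fun _ => @segment_compact _ (- M) M).
have -> : [set v : 'cV[R]_n | forall i, v i 0 \in `[- M, M]] =
    trmx @` [set v : 'rV[R]_n | forall i, v ord0 i \in `[- M, M]].
  apply/seteqP; split => [v /= H|_ [v H <-] i]; last by rewrite mxE; exact: H.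
  by exists v^T; [move=> i /=; rewrite mxE; exact: H|rewrite trmxK].
apply: continuous_compact => //; apply: continuous_subspaceT => v.
apply: mx_continuous => i.
have -> : (fun x : 'rV[R]_n => x^T i 0) = (fun x => x 0 i).
  by apply/funext => x; rewrite mxE.
exact: coord_continuous.
Qed.

Lemma cV_closed_bounded_compact n (M : R) (K : set 'cV[R]_n) :
  closed K -> (forall x i, K x -> `|x i 0| <= M) -> compact K.
Proof.
move=> cK bK; apply: (subclosed_compact cK (@cV_box_compact n M)) => x Kx i /=.
by rewrite in_itv/= -ler_norml; exact: bK.
Qed.

Lemma compact_closed_separated (U : pseudoMetricType R) (A K : set U) :
  closed A -> compact K -> A `&` K = set0 ->
  exists m : nat, forall x, K x -> ball x m.+1%:R^-1 `&` A = set0.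
Proof.
move=> cA /compact_near_coveringP cK AK0.
have [] := cK nat \oo (fun m x => ball x m.+1%:R^-1 `&` A = set0).
  move=> x Kx.
  have : nbhs x (~` A).
    apply: open_nbhs_nbhs; split; first exact: closed_openC.
    by move=> Ax; have : (A `&` K) x by []; rewrite AK0.
  move=> /nbhs_ballP[e /= e0 eA].
  exists (ball x (e / 2), [set m | m.+1%:R^-1 < e / 2]) => /=.
    split; first by apply: (@nbhsx_ballx R U); apply: divr_gt0.
    by apply: near_infty_natSinv_lt (PosNum (divr_gt0 e0 (ltr0n _ 2))).
  move=> [x' m] /= [xx' me]; rewrite -subset0 => z [/= x'z Az].
  apply: (eA z) => //; rewrite [e]splitr; apply: ball_triangle xx' _.
  by apply: le_ball x'z; exact: ltW.
move=> m _ H; exists m => x Kx; exact: (H m (leqnn m) x Kx).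
Qed.

(** This is what reduces the measurability of hitting a compact set to the
    measurability of hitting open sets. *)
Lemma hit_compactP (U : pseudoMetricType R) (A K : set U) :
  closed A -> compact K ->
  A `&` K !=set0 <->
  forall m : nat, A `&` \bigcup_(x in K) (ball x m.+1%:R^-1)° !=set0.
Proof.
move=> cA cK; split => [[x [Ax Kx]] m|H].
  exists x; split => //; exists x => //; apply: nbhsx_ballx.
  by rewrite invr_gt0.
apply/set0P/negP => /eqP /(compact_closed_separated cA cK)[m Hm].
have [z [Az [x Kx /interior_subset xz]]] := H m.
by have : (ball x m.+1%:R^-1 `&` A) z by []; rewrite (Hm x Kx).
Qed.

Lemma hit_sigma_compact_measurable d (Omega : measurableType d)
    (U : pseudoMetricType R) (Phi : Omega -> set U) (K : nat -> set U) :
  (forall w, closed (Phi w)) -> setmap_measurable measurable Phi ->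
  (forall n, compact (K n)) ->
  measurable [set w | Phi w `&` \bigcup_n K n !=set0].
Proof.
move=> cPhi mPhi cK.
have -> : [set w | Phi w `&` \bigcup_n K n !=set0] =
    \bigcup_n \bigcap_m [set w | Phi w `&` \bigcup_(x in K n) (ball x m.+1%:R^-1)° !=set0].
  apply/seteqP; split => w.
    move=> [x [Px [n _ Kx]]]; exists n => // m _; move: m.
    by apply/hit_compactP => //; exists x.
  move=> [n _ H]; have [x [Px Kx]] := (hit_compactP (cPhi w) (cK n)).2 (fun m => H m I).
  by exists x; split => //; exists n.
apply: bigcupT_measurable => n; apply: bigcapT_measurable => m.
by apply: mPhi; apply: bigcup_open => x _; exact: open_interior.
Qed.

Lemma closed_sigma_compact n (F : set (R * 'cV[R]_n)) : closed F ->
  exists2 K : nat -> set (R * 'cV[R]_n), F = \bigcup_m K m &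
    forall m, compact (K m).
Proof.
move=> cF.
pose B (m : nat) : set (R * 'cV[R]_n) := `[- m%:R, m%:R]%classic `*`
  [set v : 'cV[R]_n | forall i, v i 0 \in `[- m%:R, m%:R]].
have cB m : compact (B m).
  by apply: compact_setX; [exact: segment_compact|exact: cV_box_compact].
exists (fun m => F `&` B m).
  rewrite -setI_bigcupr; apply/seteqP; split => [|x []//].
  move=> [t v] Ftv; split => //.
  exists (Num.truncn (Num.max `|t| `|v|)).+1 => //=.
  have h := ltW (truncnS_gt (Num.max `|t| `|v|)).
  have vi i : `|v i 0| <= `|v|.
    rewrite [leRHS]mx_normrE; apply/bigmax_geP; right => /=; by exists (i, 0).
  split => [|i]; rewrite /= in_itv/= -ler_norml (le_trans _ h)// le_max ?lexx//.
  by rewrite vi orbT.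
move=> m; apply: (subclosed_compact _ (cB m)); last exact: subIsetr.
apply: closedI => //; apply: compact_closed (cB m); exact: norm_hausdorff.
Qed.

Lemma continuous_sum_fun (T : topologicalType) n (f : 'I_n -> T -> R) (x : T) :
  (forall i, {for x, continuous (f i)}) ->
  {for x, continuous (fun y => \sum_i f i y)}.
Proof.
move=> H; have -> : (fun y => \sum_i f i y) = \sum_i f i.
  by apply/funext => y; rewrite fct_sumE.
apply: (big_ind (fun g : T -> R => {for x, continuous g})).
- exact: cvg_cst.
- by move=> g h gc hc; apply: cvgD.
- by move=> i _; exact: H.
Qed.

Lemma enorm_continuous n : continuous (@enorm R n).
Proof.
move=> x; apply: continuous_comp; last exact: sqrt_continuous.
apply: continuous_sum_fun => i.
apply: (@continuous_comp _ _ _ (fun y : 'cV[R]_n => y i 0) (fun r : R => r ^+ 2)).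
  exact: coord_continuous.
exact: exprn_continuous.
Qed.

Lemma subr_continuous_l (V : normedModType R) (s : V) : continuous (fun x : V => x - s).
Proof. by move=> x; apply: cvgB; [exact: cvg_id|exact: cvg_cst]. Qed.

Lemma eball_open n (A : set 'cV[R]_n) e : open (eball A e).
Proof.
have -> : eball A e = \bigcup_(s in A) [set x | enorm (x - s) < e].
  by apply/seteqP; split => x [s]; exists s.
apply: bigcup_open => s _.
have c : continuous (fun x : 'cV[R]_n => enorm (x - s)).
  move=> x; apply: (@continuous_comp _ _ _ (fun x : 'cV[R]_n => x - s) (@enorm R n)).
    exact: subr_continuous_l.
  exact: enorm_continuous.
exact: (@open_comp _ _ _ [set r : R | r < e] (fun x _ => c x) (@open_lt R e)).
Qed.

Lemma pair_continuous (X Y Z : topologicalType) (f : X -> Y) (g : X -> Z) :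
  continuous f -> continuous g -> continuous (fun x => (f x, g x)).
Proof. by move=> fc gc x; apply: cvg_pair; [exact: fc|exact: gc]. Qed.

Lemma comp_continuous (X Y Z : topologicalType) (f : X -> Y) (g : Y -> Z) :
  continuous f -> continuous g -> continuous (fun x => g (f x)).
Proof. by move=> fc gc x; apply: continuous_comp; [exact: fc|exact: gc]. Qed.

Lemma fst_continuous (X Y : topologicalType) : continuous (@fst X Y).
Proof. by move=> x; exact: cvg_fst. Qed.

Lemma snd_continuous (X Y : topologicalType) : continuous (@snd X Y).
Proof. by move=> x; exact: cvg_snd. Qed.

(** The complement is the event that the graph of the solution hits a closed set
    of hybrid times and states. The graph is cut into the slices with a fixed jump
    counter [j], which live in the metric space [R * 'cV[R]_N]. *)
Lemma stays_within_measurable N d (Omega : measurableType d)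
    (y : Omega -> arc R N) (A : set 'cV[R]_N) (e T : R) :
  stochastic_hybrid_arc y -> measurable (stays_within A e T y).
Proof.
move=> [_ [yc ym]].
pose F j := [set p : R * 'cV[R]_N | T - j%:R <= p.1 /\ (~` eball A e) p.2].
have cF j : closed (F j).
  apply: closedI.
    apply: ((continuous_closedP fst).1 _ [set r | T - j%:R <= r]).
      by move=> p; exact: cvg_fst.
    exact: closed_ge.
  apply: ((continuous_closedP snd).1 _ (~` eball A e)).
    by move=> p; exact: cvg_snd.
  by apply: open_closedC; exact: eball_open.
pose Phi j w := [set p : R * 'cV[R]_N | hgraph (y w) (p.1, j, p.2)].
have cPhi j w : closed (Phi j w).
  apply: ((continuous_closedP (fun p : R * 'cV[R]_N => (p.1, j, p.2))).1 _ (hgraph (y w))) => //.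
  apply: pair_continuous; last exact: snd_continuous.
  by apply: pair_continuous; [exact: fst_continuous|exact: cst_continuous].
have mPhi j : setmap_measurable measurable (Phi j).
  move=> O oO.
  have -> : [set w | Phi j w `&` O !=set0] = [set w | hgraph (y w) `&`
      ((fun p : R * nat * 'cV[R]_N => p.1.2) @^-1` [set j] `&` 
       (fun p : R * nat * 'cV[R]_N => (p.1.1, p.2)) @^-1` O) !=set0].
    apply/seteqP; split => w [].
      by move=> p [Pp Op]; exists (p.1, j, p.2); split => //; split => //=; case: (p) Op.
    by move=> [[t j'] s] [/= gp [/= jj' Op]]; exists (t, s); rewrite /Phi/= -jj'.
  apply: ym; apply: openI.
    apply: (@open_comp _ _ _ [set j]); last exact: discrete_open.
    move=> p _; apply: (@comp_continuous _ _ _ fst snd);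
      [exact: fst_continuous|exact: snd_continuous].
  apply: open_comp => // p _; apply: pair_continuous; last exact: snd_continuous.
  by apply: comp_continuous; exact: fst_continuous.
rewrite -[stays_within _ _ _ _]setCK; apply: measurableC.
have -> : ~` stays_within A e T y = \bigcup_j [set w | Phi j w `&` F j !=set0].
  apply/seteqP; split => w.
    rewrite /stays_within/= => /existsNP[t /existsNP[j /not_implyP[ytj /not_implyP[Ttj nA]]]].
    exists j => //; exists (t, hval (y w) t j); split => //; split => //=.
    by rewrite lerBlDr.
  move=> [j _ [[t s] [[/= ytj ->] [/= Ttj nA]]]] /(_ t j ytj).
  by rewrite -lerBlDr => /(_ Ttj).
apply: bigcupT_measurable => j.
have [K -> cK] := closed_sigma_compact (cF j).
exact: hit_sigma_compact_measurable.
Qed.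

End compactness.

(** * Euclidean calculus of column vectors *)

Section euclidean.
Variable R : realType.

Definition dot n (x y : 'cV[R]_n) : R := \sum_i x i 0 * y i 0.
Notation nsq x := (dot x x).

Section dot.
Variable n : nat.
Implicit Types (x y z : 'cV[R]_n) (c : R).

Lemma dotC x y : dot x y = dot y x.
Proof. by apply: eq_bigr => i _; rewrite mulrC. Qed.

Lemma dotDl x y z : dot (x + y) z = dot x z + dot y z.
Proof. by rewrite -big_split; apply: eq_bigr => i _; rewrite mxE mulrDl. Qed.

Lemma dotZl c x y : dot (c *: x) y = c * dot x y.
Proof. by rewrite mulr_sumr; apply: eq_bigr => i _; rewrite mxE mulrA. Qed.

Lemma dotNl x y : dot (- x) y = - dot x y.
Proof. by rewrite -scaleN1r dotZl mulN1r. Qed.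

Lemma dotDr x y z : dot z (x + y) = dot z x + dot z y.
Proof. by rewrite dotC dotDl ![dot z _]dotC. Qed.

Lemma dotZr c x y : dot x (c *: y) = c * dot x y.
Proof. by rewrite dotC dotZl dotC. Qed.

Lemma dotNr x y : dot x (- y) = - dot x y.
Proof. by rewrite dotC dotNl dotC. Qed.

Lemma dot0l x : dot 0 x = 0.
Proof. by rewrite -(scale0r 0) dotZl mul0r. Qed.

Definition dotE := (dotDl, dotDr, dotZl, dotZr, dotNl, dotNr).

Lemma nsq_ge0 x : 0 <= nsq x.
Proof. by apply: sumr_ge0 => i _; rewrite -expr2 sqr_ge0. Qed.

Lemma nsq_eq0 x : nsq x = 0 -> x = 0.
Proof.
move/eqP; rewrite psumr_eq0 => [/allP H|i _]; last by rewrite -expr2 sqr_ge0.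
apply/matrixP => i j; rewrite ord1 mxE; apply/eqP.
by have := H i (mem_index_enum _); rewrite -expr2 sqrf_eq0.
Qed.

Lemma enormE x : enorm x = Num.sqrt (nsq x).
Proof. by congr Num.sqrt; apply: eq_bigr => i _; rewrite expr2. Qed.

Lemma enorm_sqr x : enorm x ^+ 2 = nsq x.
Proof. by rewrite enormE sqr_sqrtr// nsq_ge0. Qed.

Lemma enorm_ge0 x : 0 <= enorm x.
Proof. exact: sqrtr_ge0. Qed.

(** Young's inequality; expand [0 <= |c x - y|^2]. *)
Lemma dot_young c x y : 0 < c -> 2 * dot x y <= c * nsq x + c^-1 * nsq y.
Proof.
move=> c0; have := nsq_ge0 (c *: x - y).
rewrite !dotE (dotC y x) => h.
have : 0 <= c^-1 * (c * (c * nsq x) - c * dot x y - (c * dot x y - nsq y)).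
  by apply: mulr_ge0; [rewrite invr_ge0 ltW|lra].
have -> : c^-1 * (c * (c * nsq x) - c * dot x y - (c * dot x y - nsq y)) =
    c * nsq x + c^-1 * nsq y - 2 * dot x y.
  by field; rewrite gt_eqF.
by move=> ?; lra.
Qed.

Lemma dot_cauchy x y : dot x y ^+ 2 <= nsq x * nsq y.
Proof.
have [y0|y0] := eqVneq (nsq y) 0.
  by rewrite (nsq_eq0 y0) dotC dot0l expr0n/= dot0l mulr0.
have y1 : 0 < nsq y by rewrite lt_neqAle eq_sym y0 nsq_ge0.
have := nsq_ge0 (nsq y *: x - dot x y *: y).
rewrite !dotE (dotC y x) => h.
rewrite -(ler_pM2l y1); lra.
Qed.

Lemma nsqD_le x y : nsq (x + y) <= 2 * nsq x + 2 * nsq y.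
Proof. by have := nsq_ge0 (x - y); rewrite !dotE (dotC y x); lra. Qed.

Lemma dot_eqP x y : (forall v, dot x v = dot y v) -> x = y.
Proof.
move=> H; apply/eqP; rewrite -subr_eq0; apply/eqP; apply: nsq_eq0.
by rewrite dotDl dotNl H subrr.
Qed.

End dot.

Lemma dot_mulmxr m n (M : 'M[R]_(m, n)) x y : dot x (M *m y) = dot (M^T *m x) y.
Proof.
rewrite /dot; under eq_bigr do rewrite mxE mulr_sumr.
rewrite exchange_big/=; apply: eq_bigr => j _.
rewrite mxE mulr_suml; apply: eq_bigr => i _; rewrite mxE; ring.
Qed.

Lemma quad_dot n (M : 'M[R]_n) x : (x^T *m M *m x) 0 0 = dot x (M *m x).
Proof. by rewrite -mulmxA mxE; apply: eq_bigr => i _; rewrite mxE. Qed.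

Lemma nsq_mulmx_le m n (M : 'M[R]_(m, n)) :
  exists2 C : R, 0 <= C & forall x, nsq (M *m x) <= C * nsq x.
Proof.
exists (\sum_i nsq (row i M)^T); first by apply: sumr_ge0 => i _; exact: nsq_ge0.
move=> x; rewrite mulr_suml; apply: ler_sum => i _.
rewrite -expr2; apply: le_trans (dot_cauchy _ _).
rewrite le_eqVlt; apply/orP; left; apply/eqP; congr (_ ^+ 2).
by rewrite mxE; apply: eq_bigr => j _; rewrite !mxE.
Qed.

Lemma is_derive_dot n (X Y : R -> 'cV[R]_n) (t : R) dX dY :
  is_derive t (1 : R) X dX -> is_derive t (1 : R) Y dY ->
  is_derive t (1 : R) (fun t => dot (X t) (Y t)) (dot dX (Y t) + dot (X t) dY).
Proof.
move=> /is_derive_mxP Xd /is_derive_mxP Yd.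
have -> : (fun t => dot (X t) (Y t)) =
    \sum_i ((fun t => X t i 0) * (fun t => Y t i 0)).
  by apply/funext => s; rewrite fct_sumE.
have S := @is_derive_sum R R R n (fun i => (fun t => X t i 0) * (fun t => Y t i 0))
  t 1 _ (fun i => is_deriveM (Xd i) (Yd i)).
apply: is_derive_eq S _.
rewrite -big_split; apply: eq_bigr => i _ /=.
by rewrite /GRing.scale/=; ring.
Qed.

Lemma is_derive_mulmx m n (M : 'M[R]_(m, n)) (X : R -> 'cV[R]_n) (t : R) dX :
  is_derive t (1 : R) X dX ->
  is_derive t (1 : R) (fun t => M *m X t) (M *m dX).
Proof.
move=> Xd; apply/is_derive_mxP => i.
have := is_derive_dot (is_derive_cst (row i M)^T t 1) Xd.
rewrite dot0l add0r /cst => H.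
have -> : (M *m dX) i 0 = dot (row i M)^T dX.
  by rewrite mxE; apply: eq_bigr => j _; rewrite !mxE.
suff <- : (fun t => dot (row i M)^T (X t)) = (fun t => (M *m X t) i 0) by [].
by apply/funext => s; rewrite mxE; apply: eq_bigr => j _; rewrite !mxE.
Qed.

Lemma derive_grad n (f : 'cV[R]_n -> R) x v : differentiable f x ->
  'D_v f x = dot (grad f x) v.
Proof.
move=> fd; rewrite deriveE//.
have {1}-> : v = \sum_i v i 0 *: delta_mx i 0.
  by rewrite {1}[v]matrix_sum_delta; apply: eq_bigr => i _; rewrite big_ord1.
rewrite linear_sum; apply: eq_bigr => i _.
by rewrite linearZ/= mxE -deriveE// mulrC.
Qed.

Lemma is_derive_grad n (f : 'cV[R]_n -> R) (X : R -> 'cV[R]_n) t dX :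
  differentiable f (X t) -> is_derive t (1 : R) X dX ->
  is_derive t (1 : R) (fun t => f (X t)) (dot (grad f (X t)) dX).
Proof.
move=> fd [Xd <-].
have Xdiff : differentiable X t by apply/derivable1_diffP.
have D : differentiable (f \o X) t by exact: differentiable_comp.
apply: DeriveDef; first exact/derivable1_diffP.
by rewrite deriveE// diff_comp//= -deriveE// derive_grad// -deriveE.
Qed.

Lemma is_derive_line n (x v : 'cV[R]_n) (t : R) :
  is_derive t (1 : R) (fun s : R => x + s *: v) v.
Proof.
apply/is_derive_mxP => i.
have -> : (fun s : R => (x + s *: v) i 0) = (fun s => x i 0 + s * v i 0).
  by apply/funext => s; rewrite !mxE.
apply: is_derive_eq; rewrite /GRing.scale/=; ring.
Qed.

Lemma is_derive_uniq (f : R -> R) (t a b : R) :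
  is_derive t (1 : R) f a -> is_derive t (1 : R) f b -> a = b.
Proof. by move=> [_ <-] [_ <-]. Qed.

(** Both sides give the derivative of the function along each line through [u]. *)
Lemma grad_comp_affine n p (f : 'cV[R]_n -> R) (g : 'cV[R]_p -> R)
    (H : 'M[R]_(p, n)) (d : 'cV[R]_p) (u : 'cV[R]_n) :
  differentiable f u -> differentiable g (H *m u + d) ->
  differentiable (fun u => f u + g (H *m u + d)) u ->
  grad (fun u => f u + g (H *m u + d)) u = grad f u + H^T *m grad g (H *m u + d).
Proof.
move=> fd gd fgd; apply: dot_eqP => v.
have L := is_derive_line u v 0.
have u0 : u + 0 *: v = u by rewrite scale0r addr0.
have D1 := is_derive_grad (X := fun s : R => u + s *: v) (t := 0)
  (f := fun u => f u + g (H *m u + d)) (dX := v).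
rewrite u0 in D1; have {}D1 := D1 fgd L.
have D2 := is_derive_grad (X := fun s : R => u + s *: v) (t := 0) (f := f) (dX := v).
rewrite u0 in D2; have {}D2 := D2 fd L.
have LH : is_derive (0 : R) (1 : R) (fun s : R => H *m (u + s *: v) + d) (H *m v).
  have := is_deriveD (is_derive_mulmx H L) (is_derive_cst d (0 : R) 1).
  by rewrite addr0.
have D3 := is_derive_grad (X := fun s : R => H *m (u + s *: v) + d) (t := 0) (f := g) (dX := H *m v).
rewrite u0 in D3; have {}D3 := D3 gd LH.
rewrite (is_derive_uniq D1 (is_deriveD D2 D3)).
by rewrite dot_mulmxr dotDl.
Qed.

(** The quadratic form attains a positive minimum on the unit sphere. The sphere is
    empty in dimension [0]. *)
Lemma posdef_coercive n (M : 'M[R]_n) :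
  (forall x, x != 0 -> 0 < dot x (M *m x)) ->
  exists2 c : R, 0 < c & forall x, c * nsq x <= dot x (M *m x).
Proof.
move=> Mpos.
pose S := [set x : 'cV[R]_n | nsq x = 1].
have dotc (K : 'M[R]_n) : continuous (fun x : 'cV[R]_n => dot x (K *m x)).
  move=> x; apply: continuous_sum_fun => i.
  apply: continuousM; first exact: coord_continuous.
  have -> : (fun y : 'cV[R]_n => (K *m y) i 0) = (fun y => \sum_j K i j * y j 0).
    by apply/funext => y; rewrite mxE.
  apply: continuous_sum_fun => j; apply: continuousM; first exact: cst_continuous.
  exact: coord_continuous.
have nsqc : continuous (fun x : 'cV[R]_n => nsq x).
  have -> : (fun x : 'cV[R]_n => nsq x) = (fun x => dot x (1%:M *m x)).
    by apply/funext => x; rewrite mul1mx.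
  exact: dotc.
have cS : compact S.
  apply: (@cV_closed_bounded_compact R n 1).
    exact: ((continuous_closedP (fun x : 'cV[R]_n => nsq x)).1 nsqc [set 1] (@closed_eq _ 1)).
  move=> x i Sx; apply: le_trans (enorm_coord x i) _.
  by rewrite enormE Sx sqrtr1.
have [S0|/set0P S0] := eqVneq S set0.
  exists 1 => // x; have [x0|x0] := eqVneq x 0.
    by rewrite x0 !dot0l mulr0.
  have nx : 0 < nsq x.
    rewrite lt_neqAle nsq_ge0 andbT eq_sym; apply: contra_neq x0 => /nsq_eq0//.
  have : S ((Num.sqrt (nsq x))^-1 *: x).
    rewrite /S/= !dotE mulrA -invfM -expr2 sqr_sqrtr ?nsq_ge0// mulVf ?gt_eqF//.
  by rewrite S0.
have [x0 Sx0 min] := compact_EVT_min S0 cS (continuous_subspaceT (@dotc M)).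
rewrite inE in Sx0.
exists (dot x0 (M *m x0)).
  apply: Mpos; apply/eqP => h; move: Sx0; rewrite /S/= h dot0l => /esym/eqP.
  by rewrite oner_eq0.
move=> x; have [->|x0n] := eqVneq x 0; first by rewrite !dot0l mulr0.
have nx : 0 < nsq x.
  rewrite lt_neqAle nsq_ge0 andbT eq_sym; apply: contra_neq x0n => /nsq_eq0//.
pose c := (Num.sqrt (nsq x))^-1.
have c2 : c * c = (nsq x)^-1 by rewrite /c -invfM -expr2 sqr_sqrtr ?nsq_ge0.
have := min (c *: x); rewrite inE /S/= !dotE -scalemxAr !dotE !mulrA c2.
rewrite mulVf ?gt_eqF// => /(_ erefl).
by rewrite mulrC ler_pdivlMr.
Qed.

End euclidean.
Notation nsq x := (dot x x).

(** * Decrease along curves *)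

Section decay.
Variable R : realType.
Implicit Types (a b t : R).

Lemma is_derive_nonincreasing a b (g dg : R -> R) : a <= b -> continuous g ->
  (forall t, a < t < b -> is_derive t (1 : R) g (dg t)) ->
  (forall t, a < t < b -> dg t <= 0) -> g b <= g a.
Proof.
move=> ab gc gd dg0.
apply: (@ler0_derive1_le_cc R g a b) => //.
- by move=> t; rewrite in_itv/= => /gd[].
- move=> t; rewrite in_itv/= => tab; have [_ E] := gd t tab.
  by rewrite derive1E E dg0.
- exact: continuous_subspaceT.
- by rewrite in_itv/= lexx ab.
- by rewrite in_itv/= lexx ab.
Qed.

Lemma small_pos (x1 x2 x3 y1 y2 y3 : R) : 0 <= x1 -> 0 <= x2 -> 0 <= x3 ->
  0 < y1 -> 0 < y2 -> 0 < y3 ->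
  exists2 d : R, 0 < d & [/\ d * x1 <= y1, d * x2 <= y2 & d * x3 <= y3].
Proof.
move=> x10 x20 x30 y10 y20 y30.
have P (x y : R) : 0 <= x -> 0 < y -> 0 < y / (x + 1) by move=> *; apply: divr_gt0 => //; lra.
exists (Num.min (y1 / (x1 + 1)) (Num.min (y2 / (x2 + 1)) (y3 / (x3 + 1)))).
  by rewrite !lt_min !P.
have Q (d x y : R) : 0 <= x -> 0 < y -> d <= y / (x + 1) -> d * x <= y.
  move=> x0 y0; rewrite ler_pdivlMr; last by lra.
  move=> h; have [d0|d0] := leP 0 d; first by lra.
  by apply: le_trans (ltW y0); rewrite mulr_le0_ge0// ltW.
by split; apply: Q => //; rewrite !ge_min lexx ?orbT.
Qed.

(** [V] dissipates only [Np] and [Nz], whereas [X] decreases at rate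
    [Phi + m / 4 * Nu] up to multiples of [Np] and [Nz]. With
    [del t = d (t - a)^2 (b - t)^2], the function [V + del * X] agrees with [V] at
    [a] and [b] and decreases at rate at least [del * V]. The double zeros of [del]
    give [ddel^2 <= 4 d h^2 del], so that the extra term [ddel * X] is absorbed by
    [Np] and [del * Nu], for small [d]. As [V b <= V t], integrating yields
    [V b * (1 + d h^5 / 30) <= V a]. *)
Lemma interval_contraction (beta m C h : R) : 0 < beta -> 0 < m -> 0 <= C -> 0 < h ->
  exists2 kappa : R, 0 < kappa < 1 &
  forall (a b : R) (V X Phi Np Nz Nu dV dX : R -> R), b - a = h ->
  continuous V -> continuous X ->
  (forall t, a < t < b -> is_derive t (1 : R) V (dV t)) ->
  (forall t, a < t < b -> is_derive t (1 : R) X (dX t)) ->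
  (forall t, [/\ 0 <= Np t, 0 <= Nz t & 0 <= Nu t]) ->
  (forall t c r, 0 < c -> 2 * (r * X t) <= c * Np t + c^-1 * (r ^+ 2 * Nu t)) ->
  (forall t, V t <= Phi t + Np t / 2 + C * Nz t) ->
  (forall t, dV t <= - (beta / 2) * Np t - Nz t) ->
  (forall t, dX t <= C * Np t + C * Nz t - Phi t - m / 4 * Nu t) ->
  V b <= kappa * V a.
Proof.
move=> beta0 m0 C0 h0.
have [||||||d d0 [d1 d2 d3]] := @small_pos (h ^+ 2) (h ^+ 4 * (C + 1 / 2)) (h ^+ 4 * (C + C))
  (m * beta / 32) (3 * beta / 8) 1.
- exact: sqr_ge0.
- by apply: mulr_ge0; [exact/exprn_ge0/ltW|lra].
- by apply: mulr_ge0; [exact/exprn_ge0/ltW|lra].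
- by rewrite divr_gt0// mulr_gt0.
- by lra.
- by [].
have h5 : 0 < h ^+ 5 by rewrite exprn_gt0.
have k0 : 0 < d * h ^+ 5 / 30 by rewrite divr_gt0// mulr_gt0.
exists (1 + d * h ^+ 5 / 30)^-1.
  by rewrite invr_gt0 invf_lt1; lra.
move=> a b V X Phi Np Nz Nu dV dX bah Vc Xc Vd Xd pos XY VP dVle dXle.
have ab : a < b by lra.
have Vle t : a <= t -> t <= b -> V b <= V t.
  move=> at_ tb; apply: (@is_derive_nonincreasing t b V dV) => //.
    by move=> s /andP[s1 s2]; apply: Vd; rewrite s2 (le_lt_trans at_).
  move=> s _; have [? ? ?] := pos s; apply: le_trans (dVle s) _.
  have : 0 <= beta / 2 * Np s by apply: mulr_ge0 => //; lra.
  by lra.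
(* [ddel] is the derivative of [del], and [Del] its primitive vanishing at [a]. *)
pose del t := d * ((t - a) ^+ 2 * (b - t) ^+ 2).
pose ddel t := d * (2 * (t - a) * (b - t) * (h - 2 * (t - a))).
pose Del t := d * ((t - a) ^+ 5 / 5 - h * (t - a) ^+ 4 / 2 + h ^+ 2 * (t - a) ^+ 3 / 3).
have deld t : is_derive t (1 : R) del (ddel t).
  apply: is_derive_eq; rewrite /ddel -bah /GRing.scale/=; by ring.
have Deld t : is_derive t (1 : R) Del (del t).
  apply: is_derive_eq; rewrite /del -bah /GRing.scale/=; by field.
have dc (f df : R -> R) : (forall t, is_derive t (1 : R) f (df t)) -> continuous f.
  move=> fd t; apply: differentiable_continuous; apply/derivable1_diffP.
  by have [] := fd t.
pose g t := V t + del t * X t + V b * Del t.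
have : g b <= g a.
  apply: (@is_derive_nonincreasing a b g
    (fun t => dV t + (del t * dX t + ddel t * X t) + V b * del t)).
  - exact: ltW.
  - move=> t; apply: cvgD; last by apply: cvgM; [exact: cvg_cst|exact: (dc _ _ Deld)].
    by apply: cvgD; [exact: Vc|apply: cvgM; [exact: (dc _ _ deld)|exact: Xc]].
  - move=> t tab.
    have H := is_deriveD (is_deriveD (Vd t tab) (is_deriveM (deld t) (Xd t tab)))
      (is_deriveM (is_derive_cst (V b) t 1) (Deld t)).
    apply: is_derive_eq H _; rewrite /GRing.scale/= /cst; ring.
  move=> t /andP[at_ tb].
  have [Np0 Nz0 Nu0] := pos t.
  set s := t - a; have s0 : 0 < s by rewrite /s; lra.
  have hs : 0 < h - s by rewrite /s; lra.
  have bt : b - t = h - s by rewrite /s; lra.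
  have del0 : 0 <= del t.
    by apply: mulr_ge0; [exact: ltW|apply: mulr_ge0; exact: sqr_ge0].
  have delh : del t <= d * h ^+ 4.
    rewrite /del ler_wpM2l ?(ltW d0)// -/s bt -exprMn.
    rewrite (_ : h ^+ 4 = (h * h) ^+ 2); last by ring.
    by rewrite lerXn2r ?nnegrE ?mulr_ge0 ?ltW//; nra.
  have dd : ddel t ^+ 2 <= 4 * (d * h ^+ 2) * del t.
    have -> : ddel t ^+ 2 = 4 * (d * (h - 2 * s) ^+ 2) * del t.
      by rewrite /ddel /del -/s bt; ring.
    rewrite ler_wpM2r// ler_pM2l ?ltr0n// ler_pM2l// -subr_ge0.
    rewrite (_ : _ - _ = 4 * (s * (h - s))); last by ring.
    by rewrite !mulr_ge0// ltW.
  have B8 : 0 < beta / 4 by lra.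
  have := XY t (beta / 4) (ddel t) B8.
  have dNu : (beta / 4)^-1 * (ddel t ^+ 2 * Nu t) <= m / 2 * (del t * Nu t).
    have -> : m / 2 * (del t * Nu t) = (beta / 4)^-1 * ((m * beta / 8 * del t) * Nu t).
      by field; rewrite gt_eqF.
    rewrite ler_pM2l ?invr_gt0// ler_wpM2r//; apply: le_trans dd _.
    by rewrite ler_wpM2r//; clear -d1; lra.
  have dX1 : del t * dX t <= del t * (C * Np t + C * Nz t - Phi t - m / 4 * Nu t).
    by rewrite ler_wpM2l.
  have Vb : V b * del t <= del t * (Phi t + Np t / 2 + C * Nz t).
    rewrite mulrC ler_wpM2l//; apply: le_trans (VP t); apply: Vle; exact: ltW.
  have E1 : del t * (C + 1 / 2) * Np t <= 3 * beta / 8 * Np t.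
    rewrite ler_wpM2r//; apply: le_trans d2.
    by rewrite mulrA ler_wpM2r//; clear -delh C0; lra.
  have E2 : del t * (C + C) * Nz t <= 1 * Nz t.
    rewrite ler_wpM2r//; apply: le_trans d3.
    by rewrite mulrA ler_wpM2r//; clear -delh C0; lra.
  by have := dVle t; clear -dNu dX1 Vb E1 E2; lra.
rewrite /g; have -> : del b = 0 by rewrite /del subrr expr0n/= !mulr0.
have -> : del a = 0 by rewrite /del subrr expr0n/= mul0r mulr0.
have -> : Del a = 0 by rewrite /Del subrr !expr0n/=; ring.
have -> : Del b = d * h ^+ 5 / 30 by rewrite /Del bah; field.
rewrite !mul0r !addr0 mulr0 addr0 => H.
by rewrite mulrC ler_pdivlMr; clear -k0 H; lra.
Qed.

End decay.

(** * Strongly convex functions *)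

Section convexity.
Variable R : realType.

Lemma derive_le0_at_left_end (h : R -> R) (c : R) : is_derive (0 : R) (1 : R) h c ->
  h 0 = 0 -> (forall t, 0 <= t <= 1 -> h t <= 0) -> c <= 0.
Proof.
move=> hd h0 hle; rewrite leNgt; apply/negP => c0.
have [|rho rho0 H] := derive_upper_gauge (is_deriveN hd) (_ : - c < - (c / 2)).
  by lra.
pose s := Num.min 1 (rho / 2).
have s0 : 0 < s by rewrite /s lt_min ltr01/= divr_gt0.
have s1 : s <= 1 by rewrite /s ge_min lexx.
have sr : s < 0 + rho by rewrite add0r /s gt_min; apply/orP; right; lra.
have := H 0 s; rewrite !fctE h0 => /(_ ltac:(lra) ltac:(lra) ltac:(lra) sr).
have := hle s; rewrite s1 ltW// => /(_ isT).
have : 0 < c / 2 * s by apply: mulr_gt0 => //; lra.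
by lra.
Qed.

(** Convexity of [f - m / 2 |.|^2] bounds [f] along the segment from [x] to [y];
    differentiate that bound at [x]. *)
Lemma strongly_convex_grad n (m : R) (f : 'cV[R]_n -> R) x y :
  differentiable f x -> strongly_convex m f ->
  f x + dot (grad f x) (y - x) + m / 2 * nsq (y - x) <= f y.
Proof.
move=> fd fcvx; set w := y - x.
have conv t : 0 <= t <= 1 ->
    f (x + t *: w) - f x - t * (f y - f x) + m / 2 * (t * (1 - t)) * nsq w <= 0.
  move=> /andP[t0 t1].
  have t01 : Itv.spec (@Itv.num_sem R) (Itv.Real `[0%Z, 1%Z]) t.
    by rewrite /=/Itv.num_sem/= num_real/= in_itv/= t0 t1.
  pose tt := Itv.mk t01.
  have := fcvx tt y x (mem_setT _) (mem_setT _).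
  have E : conv tt (y : convex_lmodType 'cV[R]_n) x = t *: y + (1 - t) *: x by [].
  have E' (a b : R^o) : conv tt a b = t * a + (1 - t) * b by [].
  rewrite E E' !enorm_sqr.
  have -> : t *: y + (1 - t) *: x = x + t *: w.
    by rewrite /w scalerBl scale1r scalerBr addrCA.
  have -> : y = x + w by rewrite /w addrC subrK.
  by rewrite !dotE (dotC y x); lra.
suff : dot (grad f x) w - (f y - f x) + m / 2 * nsq w <= 0 by lra.
apply: (@derive_le0_at_left_end (fun t => f (x + t *: w) - f x - t * (f y - f x) +
   m / 2 * (t * (1 - t)) * nsq w)) => //; last first.
  by rewrite scale0r addr0 subrr; lra.
have L := is_derive_line x w 0.
have D := is_derive_grad (X := fun s : R => x + s *: w) (t := 0) (f := f) (dX := w).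
rewrite scale0r addr0 in D; have {}D := D fd L.
pose q t := - f x - t * (f y - f x) + m / 2 * (t * (1 - t)) * nsq w.
have Q : is_derive (0 : R) (1 : R) q (- (f y - f x) + m / 2 * nsq w).
  by apply: is_derive_eq; rewrite /GRing.scale/=; ring.
have -> : (fun t : R => f (x + t *: w) - f x - t * (f y - f x) +
    m / 2 * (t * (1 - t)) * nsq w) = (fun t => f (x + t *: w)) + q.
  by apply/funext => t; rewrite fctE /q; ring.
by apply: is_derive_eq (is_deriveD D Q) _; ring.
Qed.

Lemma grad_minimizer n (f : 'cV[R]_n -> R) x : differentiable f x ->
  (forall y, f x <= f y) -> grad f x = 0.
Proof.
move=> fd fmin; apply: nsq_eq0; apply/eqP; rewrite eq_le nsq_ge0 andbT.
set w := grad f x.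
have L := is_derive_line x (- w) 0.
have D := is_derive_grad (X := fun s : R => x + s *: (- w)) (t := 0) (f := f) (dX := - w).
rewrite scale0r addr0 in D; have {}D := D fd L.
apply: (@derive_le0_at_left_end (cst (f x) - (fun t : R => f (x + t *: - w)))).
- apply: is_derive_eq (is_deriveB (is_derive_cst (f x) (0 : R) 1) D) _.
  by rewrite dotNr sub0r opprK.
- by rewrite !fctE scale0r addr0 subrr.
- by move=> t _; rewrite !fctE subr_le0.
Qed.

(** The quadratic lower bound at the origin makes the sublevel set of [f 0]
    compact. *)
Lemma strongly_convex_minimizer n (m : R) (f : 'cV[R]_n -> R) :
  0 < m -> (forall x, differentiable f x) -> strongly_convex m f ->
  exists x, unique_minimizer f x.
Proof.
move=> m0 fd fcvx.
have G x y := strongly_convex_grad y (fd x) fcvx.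
have fc : continuous f by move=> x; exact: differentiable_continuous.
pose S := [set x | f x <= f 0].
have cS : compact S.
  apply: (@cV_closed_bounded_compact R n (Num.sqrt (4 / m ^+ 2 * nsq (grad f 0)))).
    exact: ((continuous_closedP f).1 fc [set r | r <= f 0] (@closed_le _ (f 0))).
  move=> x i Sx; apply: le_trans (enorm_coord x i) _; rewrite enormE ler_wsqrtr//.
  have := G 0 x; rewrite subr0.
  have m4 : 0 < 2 / m by rewrite divr_gt0.
  have := dot_young (- grad f 0) x m4; rewrite !dotE invf_div => h1 h2.
  have h3 : m / 4 * nsq x <= nsq (grad f 0) / m by move: Sx; rewrite /S/=; lra.
  have -> : 4 / m ^+ 2 * nsq (grad f 0) = (m / 4)^-1 * (nsq (grad f 0) / m).
    by field; rewrite gt_eqF.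
  by rewrite ler_pdivlMl//; lra.
have S0 : S !=set0 by exists 0; rewrite /S/=.
have [x0 Sx0 min] := compact_EVT_min S0 cS (continuous_subspaceT fc).
rewrite inE in Sx0.
have xmin y : f x0 <= f y.
  have [h|h] := leP (f y) (f 0); first by apply: min; rewrite inE.
  by apply: le_trans (ltW h).
exists x0; split => // y ymin.
have := G x0 y; rewrite (grad_minimizer (fd x0) xmin) dot0l addr0 => h.
have := ymin x0 => h'; apply/eqP; rewrite -subr_eq0; apply/eqP; apply: nsq_eq0.
apply/eqP; rewrite eq_le nsq_ge0 andbT -(ler_pM2l (_ : 0 < m / 2)) ?divr_gt0//.
by rewrite mulr0; lra.
Qed.

Lemma smooth_nsq n (l : R) (f : 'cV[R]_n -> R) x y : 0 <= l -> smooth l f ->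
  nsq (grad f x - grad f y) <= l ^+ 2 * nsq (x - y).
Proof.
move=> l0 [_ H]; rewrite -!enorm_sqr -exprMn lerXn2r ?nnegrE ?enorm_ge0//.
by rewrite mulr_ge0// enorm_ge0.
Qed.

End convexity.

(** * The energy of the interconnection and its rate of change *)

Section energy.
Variable R : realType.

Lemma lyapunov_dot n (A P : 'M[R]_n) x : P^T = P ->
  dot x ((A^T *m P + P *m A) *m x) = 2 * dot (A *m x) (P *m x).
Proof.
move=> Ps; rewrite mulmxDl dotDr -!mulmxA dot_mulmxr trmxK.
by rewrite (dot_mulmxr P x) Ps [dot (P *m x) _]dotC; ring.
Qed.

(** The quadratic form of [A^T P + P A] vanishes on the kernel of [A]. *)
Lemma lyapunov_unitmx n (A P : 'M[R]_n) : posdef P -> negdef (A^T *m P + P *m A) ->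
  A \in unitmx.
Proof.
move=> [Ps _] [_ Q]; rewrite -unitmx_tr -row_free_unit -kermx_eq0.
apply/eqP/row_matrixP => i; rewrite row0; apply/eqP; apply: contraT => ki.
have k0 : A *m (row i (kermx A^T))^T = 0.
  by rewrite -[A in A *m _]trmxK -trmx_mul -row_mul mulmx_ker row0 trmx0.
have kn : (row i (kermx A^T))^T != 0 by rewrite -(inj_eq trmx_inj) trmxK trmx0.
by have := Q _ kn; rewrite quad_dot lyapunov_dot// k0 dot0l mulr0 ltxx.
Qed.

Variables (n n2 p0 : nat) (beta m Lphi Lphiy : R).
Variables (A P : 'M[R]_n2) (B : 'M[R]_(n2, n)) (L : 'M[R]_(p0, n2)) (d : 'cV[R]_p0).
Variables (phi_u : 'cV[R]_n -> R) (phi_y : 'cV[R]_p0 -> R) (ustar : 'cV[R]_n).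
Let H := Hss A B L.
Let phi := fun u : 'cV[R]_n => phi_u u + phi_y (H *m u + d).
Let G := invmx A *m B.

Definition excess u : R := phi_u u + phi_y (Hss A B L *m u + d) -
  (phi_u ustar + phi_y (Hss A B L *m ustar + d)).
Definition zdev (u : 'cV[R]_n) (z : 'cV[R]_n2) := z + invmx A *m B *m u.
Definition energy u (p : 'cV[R]_n) z : R :=
  excess u + nsq p / 2 + dot (zdev u z) (P *m zdev u z).
(** [pdot] and [zdot] are the components of the flow map. *)
Definition pdot u p z : 'cV[R]_n :=
  - (beta *: p) - grad phi_u u - H^T *m grad phi_y (L *m z + d).
Definition zdot (eps : R) u z : 'cV[R]_n2 := eps^-1 *: (A *m z + B *m u).

(** [energy_rate] and [cross_rate] are the derivatives along the flow of [energy]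
    and of [p . (u - ustar)]. *)
Definition energy_rate eps u p z : R :=
  dot (grad phi u) p + dot (pdot u p z) p +
  2 * dot (zdot eps u z + G *m p) (P *m zdev u z).
Definition cross_rate u p z : R := dot (pdot u p z) (u - ustar) + nsq p.

Hypotheses (beta0 : 0 < beta) (m0 : 0 < m) (Lphi0 : 0 < Lphi) (Lphiy0 : 0 < Lphiy).
Hypotheses (phi_ud : forall x, differentiable phi_u x)
  (phi_yd : forall x, differentiable phi_y x).
Hypotheses (Ppos : posdef P) (Lyap : negdef (A^T *m P + P *m A)).
Hypotheses (phi_smooth : smooth Lphi phi) (phi_cvx : strongly_convex m phi)
  (phi_y_smooth : smooth Lphiy phi_y) (ustar_min : unique_minimizer phi ustar).

Let phid x : differentiable phi x. Proof. exact: phi_smooth.1. Qed.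

Lemma grad_star : grad phi ustar = 0.
Proof. exact: grad_minimizer (phid _) ustar_min.1. Qed.

Lemma excess_lower u : m / 2 * nsq (u - ustar) <= excess u.
Proof.
have := strongly_convex_grad u (phid ustar) phi_cvx.
by rewrite grad_star dot0l addr0 /excess /phi; lra.
Qed.

(** This bound makes [- grad phi u] push the cross term down. *)
Lemma excess_grad u :
  excess u + m / 2 * nsq (u - ustar) <= dot (grad phi u) (u - ustar).
Proof.
have := strongly_convex_grad ustar (phid u) phi_cvx.
by rewrite -(opprB u ustar) dotNr dotNr dotNl opprK /excess /phi; lra.
Qed.

(** Convexity and the Lipschitz gradient suffice: apply Young's inequality to the
    right-hand side of [excess_grad]. *)
Lemma excess_upper u : excess u <= Lphi * nsq (u - ustar).
Proof.
have := excess_grad u.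
have := smooth_nsq u ustar (ltW Lphi0) phi_smooth; rewrite grad_star subr0 => h1.
have := dot_young (u - ustar) (grad phi u) Lphi0; rewrite dotC => h2.
have h3 : Lphi^-1 * nsq (grad phi u) <= Lphi * nsq (u - ustar).
  by rewrite ler_pdivrMl// mulrA -expr2.
have : 0 <= m / 2 * nsq (u - ustar) by rewrite mulr_ge0 ?nsq_ge0// ltW// divr_gt0.
by lra.
Qed.

Lemma zdotE eps u z : zdot eps u z = eps^-1 *: (A *m zdev u z).
Proof.
rewrite /zdot /zdev mulmxDr !mulmxA mulmxV ?mul1mx//.
exact: lyapunov_unitmx Lyap.
Qed.

(** The error made in the force on [p] when [phi_y] is evaluated at the output of
    the fast state instead of its steady-state output. *)
Definition grad_mismatch u z : 'cV[R]_n :=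
  H^T *m (grad phi_y (H *m u + d) - grad phi_y (L *m z + d)).

(** Here the gain [H^T] matters: by the chain rule it reconstructs the gradient of
    the composite cost. *)
Lemma pdotE u p z : pdot u p z = - (beta *: p) - grad phi u + grad_mismatch u z.
Proof.
rewrite /pdot /grad_mismatch (grad_comp_affine (phi_ud u) (phi_yd _) (phid u)).
by rewrite mulmxBr opprD !addrA addrNK.
Qed.

Lemma grad_mismatch_le : exists2 C : R, 0 <= C &
  forall u z, nsq (grad_mismatch u z) <= C * nsq (zdev u z).
Proof.
have [C1 C10 H1] := nsq_mulmx_le H^T; have [C2 C20 H2] := nsq_mulmx_le L.
exists (C1 * (Lphiy ^+ 2 * C2)); first by rewrite !mulr_ge0// ltW.
move=> u z; apply: le_trans (H1 _) _; rewrite -mulrA ler_wpM2l// -[X in _ <= X]mulrA.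
apply: le_trans (smooth_nsq _ _ (ltW Lphiy0) phi_y_smooth) _.
rewrite ler_wpM2l ?sqr_ge0//; apply: le_trans (H2 _).
have -> : H *m u + d - (L *m z + d) = - (L *m zdev u z).
  rewrite opprD addrACA subrr addr0 /zdev mulmxDr /H /Hss !mulmxA mulNmx.
  by rewrite opprD addrC.
by rewrite dotNl dotNr opprK.
Qed.

(** The bound [lam / S] on [eps] is where the fast dissipation, [lam / eps] times
    [nsq zdev], exceeds all the terms in [zdev] produced by the coupling: the
    gradient mismatch, and the motion of the steady state. *)
Lemma energy_rates : exists2 epsstar : R, 0 < epsstar &
  exists2 C : R, 0 <= C & forall eps u p z, 0 < eps < epsstar ->
  energy_rate eps u p z <= - (beta / 2) * nsq p - nsq (zdev u z) /\
  cross_rate u p z <= C * nsq p + C * nsq (zdev u z) - excess u - m / 4 * nsq (u - ustar).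
Proof.
have [Ce Ce0 He] := grad_mismatch_le.
have [Cg Cg0 Hg] := nsq_mulmx_le G; have [Cp Cp0 Hp] := nsq_mulmx_le P.
have [lam lam0 Hlam] : exists2 c : R, 0 < c &
    forall x, c * nsq x <= dot x (- (A^T *m P + P *m A) *m x).
  apply: posdef_coercive => x x0; rewrite mulNmx dotNr oppr_gt0 -quad_dot.
  exact: Lyap.2.
(* The weight in Young's inequality that turns [nsq (G *m p)] into at most
   [beta / 4 * nsq p]. *)
pose c1 := beta / (4 * (Cg + 1)).
have c10 : 0 < c1 by apply: divr_gt0 => //; lra.
pose S := 1 + Ce / beta + c1^-1 * Cp.
have S0 : 0 < S.
  have : 0 <= Ce / beta by rewrite divr_ge0// ltW.
  have : 0 <= c1^-1 * Cp by rewrite mulr_ge0// invr_ge0 ltW.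
  by rewrite /S; lra.
exists (lam / S); first exact: divr_gt0.
pose C := Num.max (1 + 2 * beta ^+ 2 / m) (2 / m * Ce).
exists C.
  rewrite /C le_max; apply/orP; right; apply: mulr_ge0 => //.
  by rewrite divr_ge0// ltW.
move=> eps u p z /andP[eps0 epss]; split.
  rewrite /energy_rate pdotE zdotE; have := He u z.
  move: (zdev u z) (grad_mismatch u z) (grad phi u) => zt e g Y4.
  rewrite !dotDl !dotNl !dotZl.
  have Y1 := dot_young e p (divr_gt0 (ltr0n _ 2) beta0); rewrite invf_div in Y1.
  have Y2 := dot_young (G *m p) (P *m zt) c10.
  have Y3 := Hlam zt; rewrite mulNmx dotNr lyapunov_dot in Y3; last exact: Ppos.1.
  have Y5 := Hg p; have Y6 := Hp zt.
  have Z0 := nsq_ge0 zt; have Z1 := nsq_ge0 p.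
  have W1 : beta^-1 * nsq e <= Ce / beta * nsq zt.
    by rewrite ler_pdivrMl// mulrA mulrCA mulfV ?gt_eqF// mulr1.
  have W2 : c1 * nsq (G *m p) <= beta / 4 * nsq p.
    apply: (@le_trans _ _ (c1 * ((Cg + 1) * nsq p))).
      by rewrite ler_pM2l//; lra.
    rewrite le_eqVlt; apply/orP; left; apply/eqP; rewrite /c1; field; lra.
  have W3 : c1^-1 * nsq (P *m zt) <= c1^-1 * Cp * nsq zt.
    by rewrite -mulrA ler_wpM2l// invr_ge0 ltW.
  have W4 : eps^-1 * (2 * dot (A *m zt) (P *m zt)) <= - S * nsq zt.
    rewrite ler_pdivrMl//; apply: (@le_trans _ _ (- (lam * nsq zt))); first lra.
    rewrite mulNr mulrN lerN2 mulrA ler_wpM2r//.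
    by move: epss; rewrite ltr_pdivlMr// => /ltW.
  rewrite /S in W4. clearbody c1. lra.
rewrite /cross_rate pdotE; have := excess_grad u; have := He u z.
move: (zdev u z) (grad_mismatch u z) (grad phi u) (u - ustar) => zt e g w Y4 Y3.
have C1 : 1 + 2 * beta ^+ 2 / m <= C by rewrite /C le_max lexx.
have C2 : 2 / m * Ce <= C by rewrite /C le_max lexx orbT.
rewrite !dotDl !dotNl !dotZl.
have m4 : 0 < 4 / m by rewrite divr_gt0.
have := dot_young (- (beta *: p)) w m4; rewrite !dotE invf_div => Y1.
have := dot_young e w m4; rewrite invf_div => Y2.
have W1 : (1 + 2 * beta ^+ 2 / m) * nsq p <= C * nsq p by rewrite ler_wpM2r ?nsq_ge0.
have W2 : 2 / m * nsq e <= C * nsq zt.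
  apply: (@le_trans _ _ (2 / m * Ce * nsq zt)).
    by rewrite -[leRHS]mulrA ler_pM2l// divr_gt0.
  by rewrite ler_wpM2r ?nsq_ge0.
have E1 : 4 / m * - (beta * - (beta * nsq p)) = 2 * (2 * beta ^+ 2 / m * nsq p) by ring.
have E2 : 4 / m * nsq e = 2 * (2 / m * nsq e) by ring.
rewrite ?E1 ?E2 in Y1 Y2; lra.
Qed.

(** The deviations of [z] from its values at the target and at the steady state of
    [u] differ by [G (u - ustar)], and [nsq (u - ustar)] is bounded by the excess. *)
Lemma energy_bounds : exists2 C : R, 0 < C & forall u p z,
  nsq (u - ustar) + nsq p + nsq (z + invmx A *m B *m ustar) <= C * energy u p z /\
  energy u p z <= C * (nsq (u - ustar) + nsq p + nsq (z + invmx A *m B *m ustar)) /\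
  energy u p z <= excess u + nsq p / 2 + C * nsq (zdev u z).
Proof.
have [Cg Cg0 Hg] := nsq_mulmx_le G; have [Cp Cp0 Hp] := nsq_mulmx_le P.
have [lam lam0 Hlam] : exists2 c : R, 0 < c & forall x, c * nsq x <= dot x (P *m x).
  by apply: posdef_coercive => x x0; rewrite -quad_dot; exact: Ppos.2.
have Hup x : dot x (P *m x) <= (1 + Cp) * nsq x.
  have := dot_young x (P *m x) ltr01; rewrite invr1 !mul1r.
  have := Hp x; have := nsq_ge0 x; have : 0 <= Cp * nsq x by rewrite mulr_ge0// nsq_ge0.
  lra.
pose C1 := (1 + 2 * Cg) * (2 / m) + 2 + 2 / lam.
pose C2 := Lphi + 1 + (1 + Cp) * 2 + (1 + Cp) * (2 * Cg).
have C10 : 0 < C1.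
  have : 0 < 2 / m by rewrite divr_gt0.
  have : 0 < 2 / lam by rewrite divr_gt0.
  have : 0 <= 2 * Cg * (2 / m) by apply: mulr_ge0; [exact: mulr_ge0|exact/ltW/divr_gt0].
  by rewrite /C1; lra.
have C20 : 0 < C2.
  have : 0 <= (1 + Cp) * (2 * Cg) by do !apply: mulr_ge0 => //; lra.
  by rewrite /C2; have := Lphi0; nra.
exists (C1 + C2); first lra.
move=> u p z.
set w := u - ustar; set zt := zdev u z; set zs := z + invmx A *m B *m ustar.
have E1 : zs = zt - G *m w.
  by rewrite /zs /zt /w /zdev mulmxBr opprB addrACA subrr addr0.
have E2 : zt = zs + G *m w by rewrite E1 addrNK.
have Nw := nsq_ge0 w; have Np := nsq_ge0 p; have Nz := nsq_ge0 zt; have Ns := nsq_ge0 zs.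
have U1 : nsq zs <= 2 * nsq zt + 2 * Cg * nsq w.
  have := nsqD_le zt (- (G *m w)); rewrite -E1 dotNr dotNl opprK.
  by have := Hg w; lra.
have U2 : nsq zt <= 2 * nsq zs + 2 * Cg * nsq w.
  have := nsqD_le zs (G *m w); rewrite -E2.
  by have := Hg w; lra.
have e1 := excess_lower u; have e2 := excess_upper u; rewrite -/w in e1 e2.
have q1 := Hlam zt; have q2 := Hup zt.
have e0 : 0 <= excess u by apply: le_trans e1; rewrite mulr_ge0// ltW// divr_gt0.
have ez : 0 <= dot zt (P *m zt) by apply: le_trans q1; rewrite mulr_ge0// ltW.
have en : 0 <= energy u p z by rewrite /energy -/zt; lra.
split; [|split].
- apply: (@le_trans _ _ (C1 * energy u p z)); last first.
    by rewrite ler_wpM2r//; lra.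
  have F1 : nsq w <= 2 / m * excess u.
    have -> : nsq w = 2 / m * (m / 2 * nsq w) by field; rewrite gt_eqF.
    by rewrite ler_pM2l// divr_gt0.
  have F2 : nsq zt <= lam^-1 * dot zt (P *m zt) by rewrite ler_pdivlMl.
  have F3 : (1 + 2 * Cg) * nsq w <= (1 + 2 * Cg) * (2 / m) * excess u.
    by rewrite -mulrA ler_wpM2l//; lra.
  have c1 : 0 <= (1 + 2 * Cg) * (2 / m) by apply: mulr_ge0; [lra|exact/ltW/divr_gt0].
  have c2 : 0 <= 2 / lam by rewrite divr_ge0// ltW.
  have G1 : (1 + 2 * Cg) * (2 / m) * excess u <= (1 + 2 * Cg) * (2 / m) * energy u p z.
    by rewrite ler_wpM2l// /energy -/zt; lra.
  have G2 : 2 / lam * dot zt (P *m zt) <= 2 / lam * energy u p z.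
    by rewrite ler_wpM2l// /energy -/zt; lra.
  have G3 : nsq p <= 2 * energy u p z by rewrite /energy -/zt; lra.
  by rewrite /C1; lra.
- apply: (@le_trans _ _ (C2 * (nsq w + nsq p + nsq zs))); last first.
    by rewrite ler_wpM2r//; lra.
  have F1 : (1 + Cp) * nsq zt <= (1 + Cp) * (2 * nsq zs + 2 * Cg * nsq w).
    by rewrite ler_wpM2l//; lra.
  have z1 : 0 <= Cp * nsq zs by rewrite mulr_ge0.
  have z2 : 0 <= Cp * nsq w by rewrite mulr_ge0.
  have z3 : 0 <= Cp * nsq p by rewrite mulr_ge0.
  have z4 : 0 <= (1 + Cp) * (2 * Cg) * nsq zs by do !apply: mulr_ge0 => //; lra.
  have z5 : 0 <= (1 + Cp) * (2 * Cg) * nsq p by do !apply: mulr_ge0 => //; lra.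
  have z6 : 0 <= Lphi * nsq zs by rewrite mulr_ge0// ltW.
  have z7 : 0 <= Lphi * nsq p by rewrite mulr_ge0// ltW.
  by rewrite /energy -/zt /C2; lra.
- have : (1 + Cp) * nsq zt <= (C1 + C2) * nsq zt.
    rewrite ler_wpM2r// /C2.
    have : 0 <= (1 + Cp) * (2 * Cg) by do !apply: mulr_ge0 => //; lra.
    have := Lphi0; lra.
  by rewrite /energy -/zt; lra.
Qed.

End energy.

(** * States as stacked vectors *)

Section blocks.
Variable R : realType.

Lemma dot_col_mx m n (a c : 'cV[R]_m) (b e : 'cV[R]_n) :
  dot (col_mx a b) (col_mx c e) = dot a c + dot b e.
Proof.
rewrite /dot big_split_ord/=; congr (_ + _); apply: eq_bigr => i _.
  by rewrite !col_mxEu.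
by rewrite !col_mxEd.
Qed.

Lemma nsq_scalar (a : R) : nsq (a%:M : 'cV[R]_1) = a ^+ 2.
Proof. by rewrite /dot big_ord1 mxE eqxx mulr1n expr2. Qed.

Lemma col_mx_continuous (T : topologicalType) m n (f : T -> 'cV[R]_m) (g : T -> 'cV[R]_n) :
  continuous f -> continuous g -> continuous (fun x => col_mx (f x) (g x)).
Proof.
move=> fc gc x; apply: mx_continuous => i.
have [[j ->]|[j ->]] : (exists j, i = lshift n j) \/ (exists j, i = rshift m j).
  by case: (splitP i) => j ij; [left|right]; exists j; exact: val_inj.
- have -> : (fun x => col_mx (f x) (g x) (lshift n j) 0) = (fun x => f x j 0).
    by apply/funext => y; rewrite col_mxEu.
  by apply: (@comp_continuous _ _ _ f (fun M : 'cV[R]_m => M j 0) fc); exact: coord_continuous.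
- have -> : (fun x => col_mx (f x) (g x) (rshift m j) 0) = (fun x => g x j 0).
    by apply/funext => y; rewrite col_mxEd.
  by apply: (@comp_continuous _ _ _ g (fun M : 'cV[R]_n => M j 0) gc); exact: coord_continuous.
Qed.

Lemma mulmx_continuous m n (M : 'M[R]_(m, n)) : continuous (fun x : 'cV[R]_n => M *m x).
Proof.
move=> x; apply: mx_continuous => i.
have -> : (fun y : 'cV[R]_n => (M *m y) i 0) = (fun y => \sum_j M i j * y j 0).
  by apply/funext => y; rewrite mxE.
apply: continuous_sum_fun => j; apply: continuousM; first exact: cst_continuous.
exact: coord_continuous.
Qed.

Lemma usubmx_continuous m n : continuous (@usubmx R m n 1).
Proof.
move=> x; apply: mx_continuous => i.
have -> : (fun y : 'cV[R]_(m + n) => usubmx y i 0) = (fun y => y (lshift n i) 0).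
  by apply/funext => y; rewrite mxE.
exact: coord_continuous.
Qed.

Lemma dsubmx_continuous m n : continuous (@dsubmx R m n 1).
Proof.
move=> x; apply: mx_continuous => i.
have -> : (fun y : 'cV[R]_(m + n) => dsubmx y i 0) = (fun y => y (rshift m i) 0).
  by apply/funext => y; rewrite mxE.
exact: coord_continuous.
Qed.

Lemma is_derive_usubmx m n (Y : R -> 'cV[R]_(m + n)) t dY :
  is_derive t (1 : R) Y dY -> is_derive t (1 : R) (fun t => usubmx (Y t)) (usubmx dY).
Proof.
move=> /is_derive_mxP H; apply/is_derive_mxP => i; rewrite mxE.
suff -> : (fun t => usubmx (Y t) i 0) = (fun t => Y t (lshift n i) 0) by [].
by apply/funext => s; rewrite mxE.
Qed.

Lemma is_derive_dsubmx m n (Y : R -> 'cV[R]_(m + n)) t dY :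
  is_derive t (1 : R) Y dY -> is_derive t (1 : R) (fun t => dsubmx (Y t)) (dsubmx dY).
Proof.
move=> /is_derive_mxP H; apply/is_derive_mxP => i; rewrite mxE.
suff -> : (fun t => dsubmx (Y t) i 0) = (fun t => Y t (rshift m i) 0) by [].
by apply/funext => s; rewrite mxE.
Qed.

End blocks.

Section state.
Variables (R : realType) (n n2 : nat).
Implicit Types (u p : 'cV[R]_n) (tau : R) (z : 'cV[R]_n2) (y : 'cV[R]_(n + n + 1 + n2)).

Lemma u_of_stack u p tau z : u_of (stack u p tau z) = u.
Proof. by rewrite /u_of /stack !col_mxKu. Qed.
Lemma p_of_stack u p tau z : p_of (stack u p tau z) = p.
Proof. by rewrite /p_of /stack !col_mxKu col_mxKd. Qed.
Lemma tau_of_stack u p tau z : tau_of (stack u p tau z) = tau.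
Proof. by rewrite /tau_of /stack col_mxKu col_mxKd mxE eqxx mulr1n. Qed.
Lemma z_of_stack u p tau z : z_of (stack u p tau z) = z.
Proof. by rewrite /z_of /stack col_mxKd. Qed.
Definition stackK := (u_of_stack, p_of_stack, tau_of_stack, z_of_stack).

Lemma stack_of y : stack (u_of y) (p_of y) (tau_of y) (z_of y) = y.
Proof.
by rewrite /stack /u_of /p_of /tau_of /z_of -mx11_scalar !vsubmxK.
Qed.

Lemma nsq_sub_stack y u p tau z :
  nsq (y - stack u p tau z) = nsq (u_of y - u) + nsq (p_of y - p) +
    (tau_of y - tau) ^+ 2 + nsq (z_of y - z).
Proof.
rewrite -{1 2}(stack_of y) /stack !opp_col_mx !add_col_mx !dot_col_mx.
by rewrite -nsq_scalar raddfB.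
Qed.

(** The squared distance to the target of a state whose timer is in [[0, T]]: the
    timer does not contribute. *)
Definition target_dist2 (G : 'M[R]_(n2, n)) (ustar : 'cV[R]_n) y : R :=
  nsq (u_of y - ustar) + nsq (p_of y) + nsq (z_of y + G *m ustar).

Lemma target_eball T (A : 'M[R]_n2) (B : 'M[R]_(n2, n)) ustar e y : 0 < e ->
  0 <= tau_of y <= T -> target_dist2 (invmx A *m B) ustar y < e ^+ 2 ->
  eball (target_set T A B ustar) e y.
Proof.
move=> e0 tauT ye; exists (stack ustar 0 (tau_of y) (- (invmx A *m B *m ustar))).
  by exists (tau_of y) => //=; rewrite in_itv.
rewrite -[ltRHS](gtr0_norm e0) -sqrtr_sqr enormE ltr_sqrt ?exprn_gt0//.
by rewrite nsq_sub_stack subrr expr0n/= addr0 subr0 opprK.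
Qed.

(** The factor [2] leaves room for the infimum in [edist] not to be attained. *)
Lemma target_edist T (A : 'M[R]_n2) (B : 'M[R]_(n2, n)) ustar r y : 0 <= T -> 0 < r ->
  edist (target_set T A B ustar) y <= r ->
  target_dist2 (invmx A *m B) ustar y <= (2 * r) ^+ 2.
Proof.
move=> T0 r0 yr.
have [||_ [_ [tau tauT <-] <-] lt] := @inf_lt R
    [set enorm (y - s) | s in target_set T A B ustar] (2 * r).
- exists (enorm (y - stack ustar 0 0 (- (invmx A *m B *m ustar)))).
  exists (stack ustar 0 0 (- (invmx A *m B *m ustar))) => //.
  by exists 0 => //=; rewrite in_itv/= lexx.
- by move: yr; rewrite /edist; lra.
have : nsq (y - stack ustar 0 tau (- (invmx A *m B *m ustar))) <= (2 * r) ^+ 2.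
  by rewrite -enorm_sqr lerXn2r ?nnegrE ?enorm_ge0 ?ltW// mulr_gt0.
rewrite nsq_sub_stack subr0 opprK; apply: le_trans.
by rewrite /target_dist2 lerD2r lerDl sqr_ge0.
Qed.

End state.

(** * Decay of the energy along flows *)

Lemma ae_lebesgue_itv (R : realType) (c b : R) (Q : R -> Prop) : c < b ->
  {ae @lebesgue_measure R, forall t, Q t} -> exists2 t, c < t < b & Q t.
Proof.
move=> cb [N [mN N0 QN]]; apply: contrapT => H.
have sub : `]c, b[%classic `<=` N.
  move=> t /=; rewrite in_itv/= => tcb; apply: QN => /= Qt.
  by apply: H; exists t.
have : (lebesgue_measure (`]c, b[%classic : set R) <= lebesgue_measure N)%E.
  by apply: le_measure; rewrite ?inE.
rewrite N0 lebesgue_measure_itv/= lte_fin cb -EFinD lee_fin; lra.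
Qed.

Section flow.
Variables (R : realType) (n n2 p0 : nat) (T beta rho m Lphi Lphiy : R).
Variables (A P : 'M[R]_n2) (B : 'M[R]_(n2, n)) (L : 'M[R]_(p0, n2)) (d : 'cV[R]_p0).
Variables (phi_u : 'cV[R]_n -> R) (phi_y : 'cV[R]_p0 -> R) (ustar : 'cV[R]_n).
Variable mu : probability (measurableTypeR R) R.
Let H := Hss A B L.
Let phi := fun u : 'cV[R]_n => phi_u u + phi_y (H *m u + d).
Let N := (n + n + 1 + n2)%N.

Hypotheses (beta0 : 0 < beta) (m0 : 0 < m) (Lphi0 : 0 < Lphi) (Lphiy0 : 0 < Lphiy).
Hypotheses (phi_uC : continuously_differentiable phi_u)
  (phi_yC : continuously_differentiable phi_y).
Hypotheses (Ppos : posdef P) (Lyap : negdef (A^T *m P + P *m A)).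
Hypotheses (phi_smooth : smooth Lphi phi) (phi_cvx : strongly_convex m phi)
  (phi_y_smooth : smooth Lphiy phi_y) (ustar_min : unique_minimizer phi ustar).

Definition field eps (y : 'cV[R]_N) : 'cV[R]_N :=
  stack (p_of y) (pdot beta A B L d phi_u phi_y (u_of y) (p_of y) (z_of y)) 1
    (zdot A B eps (u_of y) (z_of y)).

Definition state_energy (y : 'cV[R]_N) : R :=
  energy A P B L d phi_u phi_y ustar (u_of y) (p_of y) (z_of y).

Definition tuned_system eps := Hsys T beta rho A B L d H^T phi_u phi_y mu eps.

Lemma u_of_continuous : continuous (@u_of R n n2).
Proof.
apply: (@comp_continuous _ _ _ _ usubmx); last exact: usubmx_continuous.
by apply: (@comp_continuous _ _ _ usubmx usubmx); exact: usubmx_continuous.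
Qed.

Lemma p_of_continuous : continuous (@p_of R n n2).
Proof.
apply: (@comp_continuous _ _ _ _ dsubmx); last exact: dsubmx_continuous.
by apply: (@comp_continuous _ _ _ usubmx usubmx); exact: usubmx_continuous.
Qed.

Lemma z_of_continuous : continuous (@z_of R n n2).
Proof. exact: dsubmx_continuous. Qed.

Lemma addv_continuous (X : topologicalType) k (f g : X -> 'cV[R]_k) :
  continuous f -> continuous g -> continuous (fun x => f x + g x).
Proof. by move=> fc gc x; apply: continuousD; [exact: fc|exact: gc]. Qed.

Lemma addr_continuous (X : topologicalType) (f g : X -> R) :
  continuous f -> continuous g -> continuous (fun x => f x + g x).
Proof. by move=> fc gc x; apply: cvgD; [exact: fc|exact: gc]. Qed.

Lemma mulr_continuous (X : topologicalType) (f g : X -> R) :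
  continuous f -> continuous g -> continuous (fun x => f x * g x).
Proof. by move=> fc gc x; apply: cvgM; [exact: fc|exact: gc]. Qed.

Lemma scalev_continuous (X : topologicalType) k (c : R) (f : X -> 'cV[R]_k) :
  continuous f -> continuous (fun x => c *: f x).
Proof. by move=> fc x; apply: cvgZ; [exact: cvg_cst|exact: fc]. Qed.

Lemma oppv_continuous (X : topologicalType) k (f : X -> 'cV[R]_k) :
  continuous f -> continuous (fun x => - f x).
Proof. by move=> fc x; apply: continuousN; exact: fc. Qed.

Lemma field_continuous eps : continuous (field eps).
Proof.
have uc := u_of_continuous; have pc := p_of_continuous; have zc := z_of_continuous.
apply: col_mx_continuous.
  apply: col_mx_continuous; last exact: cst_continuous.
  apply: col_mx_continuous; first exact: pc.
  apply: addv_continuous; last first.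
    apply: oppv_continuous; apply: (@comp_continuous _ _ _ _ (mulmx H^T));
      last exact: mulmx_continuous.
    apply: (@comp_continuous _ _ _ _ (grad phi_y)); last exact: phi_yC.2.
    apply: addv_continuous; last exact: cst_continuous.
    by apply: (@comp_continuous _ _ _ (@z_of R n n2) (mulmx L)); last exact: mulmx_continuous.
  apply: addv_continuous.
    by apply: oppv_continuous; exact: scalev_continuous.
  apply: oppv_continuous.
  by apply: (@comp_continuous _ _ _ (@u_of R n n2) (grad phi_u)); last exact: phi_uC.2.
apply: scalev_continuous; apply: addv_continuous.
  by apply: (@comp_continuous _ _ _ (@z_of R n n2) (mulmx A)); last exact: mulmx_continuous.
by apply: (@comp_continuous _ _ _ (@u_of R n n2) (mulmx B)); last exact: mulmx_continuous.
Qed.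

Section curve.
Variables (eps : R) (Z : R -> 'cV[R]_N) (t : R).
Hypothesis Zd : is_derive t (1 : R) Z (field eps (Z t)).

Lemma is_derive_u : is_derive t (1 : R) (fun t => u_of (Z t)) (p_of (Z t)).
Proof.
have := is_derive_usubmx (is_derive_usubmx (is_derive_usubmx Zd)).
by rewrite -/(u_of (field eps (Z t))) u_of_stack.
Qed.

Lemma is_derive_p : is_derive t (1 : R) (fun t => p_of (Z t))
  (pdot beta A B L d phi_u phi_y (u_of (Z t)) (p_of (Z t)) (z_of (Z t))).
Proof.
have := is_derive_dsubmx (is_derive_usubmx (is_derive_usubmx Zd)).
by rewrite -/(p_of (field eps (Z t))) p_of_stack.
Qed.

Lemma is_derive_tau : is_derive t (1 : R) (fun t => tau_of (Z t)) 1.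
Proof.
have /is_derive_mxP /(_ 0) := is_derive_dsubmx (is_derive_usubmx Zd).
by rewrite -/(tau_of (field eps (Z t))) tau_of_stack.
Qed.

Lemma is_derive_z : is_derive t (1 : R) (fun t => z_of (Z t))
  (zdot A B eps (u_of (Z t)) (z_of (Z t))).
Proof.
have := is_derive_dsubmx Zd.
by rewrite -/(z_of (field eps (Z t))) z_of_stack.
Qed.

Lemma is_derive_energy : is_derive t (1 : R) (fun t => state_energy (Z t))
  (energy_rate beta A P B L d phi_u phi_y eps (u_of (Z t)) (p_of (Z t)) (z_of (Z t))).
Proof.
have ud := is_derive_u; have pd := is_derive_p; have zd := is_derive_z.
have ztd : is_derive t (1 : R) (fun t => zdev A B (u_of (Z t)) (z_of (Z t)))
    (zdot A B eps (u_of (Z t)) (z_of (Z t)) + invmx A *m B *m p_of (Z t)).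
  exact: is_deriveD zd (is_derive_mulmx (invmx A *m B) ud).
have D1 := is_derive_grad (phi_smooth.1 (u_of (Z t))) ud.
have D2 := is_derive_dot pd pd.
have D3 := is_derive_dot ztd (is_derive_mulmx P ztd).
pose c := phi_u ustar + phi_y (H *m ustar + d).
have D := is_deriveD (is_deriveD (is_deriveB D1 (is_derive_cst c t 1))
  (is_deriveM D2 (is_derive_cst (2^-1 : R) t 1))) D3.
apply: is_derive_eq D _.
rewrite /energy_rate /cst /GRing.scale/= mulr0 add0r.
move: (zdot _ _ _ _ _ + _) (zdev _ _ _ _) => dz zt.
rewrite (dot_mulmxr P zt) Ppos.1 [dot (P *m zt) _]dotC.
by rewrite [dot (p_of _) (pdot _ _ _ _ _ _ _ _ _ _)]dotC /phi; field.
Qed.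

Lemma is_derive_cross : is_derive t (1 : R) (fun t => dot (p_of (Z t)) (u_of (Z t) - ustar))
  (cross_rate beta A B L d phi_u phi_y ustar (u_of (Z t)) (p_of (Z t)) (z_of (Z t))).
Proof.
have D := is_derive_dot is_derive_p (is_deriveB is_derive_u (is_derive_cst ustar t 1)).
by apply: is_derive_eq D _; rewrite subr0.
Qed.

End curve.

Lemma state_energy_continuous : continuous state_energy.
Proof.
have uc := u_of_continuous; have pc := p_of_continuous; have zc := z_of_continuous.
have phic : continuous phi.
  by move=> x; apply: differentiable_continuous; exact: phi_smooth.1.
have dotc k (f g : 'cV[R]_N -> 'cV[R]_k) : continuous f -> continuous g ->
    continuous (fun x => dot (f x) (g x)).
  move=> fc gc x; apply: continuous_sum_fun => i; apply: continuousM.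
    by apply: (@comp_continuous _ _ _ f (fun M : 'cV[R]_k => M i 0) fc); exact: coord_continuous.
  by apply: (@comp_continuous _ _ _ g (fun M : 'cV[R]_k => M i 0) gc); exact: coord_continuous.
have ztc : continuous (fun y => zdev A B (@u_of R n n2 y) (@z_of R n n2 y)).
  apply: addv_continuous; first exact: zc.
  by apply: (@comp_continuous _ _ _ (@u_of R n n2) (mulmx (invmx A *m B))); last exact: mulmx_continuous.
have c1 : continuous (fun y => phi (@u_of R n n2 y))
  := @comp_continuous _ _ _ (@u_of R n n2) phi uc phic.
have c2 := dotc _ _ _ pc pc.
have c3 : continuous (fun y => P *m zdev A B (@u_of R n n2 y) (@z_of R n n2 y)).
  by apply: (@comp_continuous _ _ _ _ (mulmx P)); last exact: mulmx_continuous.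
have c4 := dotc _ _ _ ztc c3.
apply: addr_continuous; last exact: c4.
apply: addr_continuous; last by apply: mulr_continuous; [exact: c2|exact: cst_continuous].
by apply: addr_continuous; [exact: c1|exact: cst_continuous].
Qed.

(** What a random solution does on one interval of flow. *)
Definition flows_along eps a b (Y : R -> 'cV[R]_N) : Prop :=
  absolutely_continuous a b Y /\
  (a < b -> {ae @lebesgue_measure R, forall t, t \in `[a, b] ->
     flow_set (tuned_system eps) (Y t) /\
     exists2 dy, flow_map (tuned_system eps) (Y t) dy & is_derive (t : R) (1 : R) Y dy}).

Lemma flows_along_C1 eps a b Y : a < b -> flows_along eps a b Y ->
  exists Z : R -> 'cV[R]_N, [/\ continuous Z,
    forall t, a <= t <= b -> Z t = Y t &
    forall t, a < t < b -> is_derive t (1 : R) Z (field eps (Z t))].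
Proof.
move=> ab [Yac /(_ ab) Yd].
apply: ac_flow_C1 => //; [exact: ltW|exact: field_continuous|].
by apply: ae_lebesgueS Yd => t /= h /h [_ [_ ->]].
Qed.

Lemma flows_along_tau eps a b Y : a <= b -> flows_along eps a b Y ->
  tau_of (Y b) = tau_of (Y a) + (b - a).
Proof.
rewrite le_eqVlt => /predU1P[->|ab] Yf; first by rewrite subrr addr0.
have [Z [Zc ZY Zd]] := flows_along_C1 ab Yf.
rewrite -(ZY b) ?lexx ?(ltW ab)// -(ZY a) ?lexx ?(ltW ab)//.
have tc : continuous (fun t => tau_of (Z t)).
  have h : continuous (@tau_of R n n2).
    apply: (@comp_continuous _ _ _ _ (fun M : 'cV[R]_1 => M 0 0));
      last exact: coord_continuous.
    by apply: (@comp_continuous _ _ _ _ dsubmx); [exact: usubmx_continuous|exact: dsubmx_continuous].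
  exact: (@comp_continuous _ _ _ Z).
have tidc : continuous (fun t : R => t) by move=> t; exact: cvg_id.
have oppc : continuous (-%R : R -> R) by exact: opp_continuous.
apply/eqP; rewrite eq_le; apply/andP; split.
  have : tau_of (Z b) - b <= tau_of (Z a) - a.
    apply: (@is_derive_nonincreasing R a b (fun t => tau_of (Z t) - t) (cst 0)).
    - exact: ltW.
    - by apply: addr_continuous => //; exact: (@comp_continuous _ _ _ _ -%R tidc oppc).
    - move=> t tab; have := is_deriveB (is_derive_tau (Zd t tab)) (is_derive_id t 1).
      by rewrite subrr.
    - by [].
  by lra.
have : b - tau_of (Z b) <= a - tau_of (Z a).
  apply: (@is_derive_nonincreasing R a b (fun t => t - tau_of (Z t)) (cst 0)).
  - exact: ltW.
  - by apply: addr_continuous => //; exact: (@comp_continuous _ _ _ _ -%R tc oppc).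
  - move=> t tab; have := is_deriveB (is_derive_id t 1) (is_derive_tau (Zd t tab)).
    by rewrite subrr.
  - by [].
by lra.
Qed.

(** Otherwise the timer exceeds [T] on an interval of positive length, where the
    state is outside of the flow set. *)
Lemma flows_along_tau_le eps a b Y : a <= b -> flows_along eps a b Y ->
  tau_of (Y a) <= T -> tau_of (Y b) <= T.
Proof.
move=> ab Yf ta; rewrite leNgt; apply/negP => tb.
have Yt t : a <= t -> t <= b -> tau_of (Y t) = tau_of (Y a) + (t - a).
  move=> at_ tb'; apply: (@flows_along_tau eps) => //; case: Yf => Yac Yae; split.
    move=> e e0; have [d' d0 H'] := Yac e e0; exists d' => // k l r lr.
    by apply: H' => i; have [? [? ?]] := lr i; split => //; split => //; exact: le_trans tb'.
  move=> at'; have := Yae (lt_le_trans at' tb').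
  apply: ae_lebesgueS => s /= h; rewrite in_itv/= => /andP[as_ st].
  by apply: h; rewrite in_itv/= as_ (le_trans st).
rewrite (Yt b ab (lexx b)) in tb.
have ab' : a < b by move: ab; rewrite le_eqVlt => /predU1P[E|//]; move: tb ta; rewrite E; lra.
have cb : a + (T - tau_of (Y a)) < b by lra.
have [t /andP[ct tb'] Q] := ae_lebesgue_itv cb (Yf.2 ab').
have tab : t \in `[a, b] by rewrite in_itv/=; apply/andP; split; lra.
have [/andP[_]] := Q tab; rewrite Yt; lra.
Qed.

(** The threshold on [eps] does not depend on the length [h] of the window. *)
Lemma flow_decay : exists2 epsstar : R, 0 < epsstar &
  (forall (eps a b : R) Y, 0 < eps < epsstar -> a <= b -> flows_along eps a b Y ->
     state_energy (Y b) <= state_energy (Y a)) /\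
  (forall h : R, 0 < h -> exists2 kappa : R, 0 < kappa < 1 &
    forall (eps a b : R) Y, 0 < eps < epsstar -> a + h <= b -> flows_along eps a b Y ->
      state_energy (Y b) <= kappa * state_energy (Y a)).
Proof.
have [es es0 [C1 C10 rates]] := energy_rates ustar beta0 m0 Lphiy0 phi_uC.1 phi_yC.1
  Ppos Lyap phi_smooth phi_cvx phi_y_smooth.
have [C2 C20 bounds] := energy_bounds m0 Lphi0 Ppos phi_smooth phi_cvx ustar_min.
exists es => //.
have nonincr (eps a b a' b' : R) (Z : R -> 'cV[R]_N) : 0 < eps < es -> a <= a' -> a' <= b' -> b' <= b ->
    continuous Z -> (forall t, a < t < b -> is_derive t (1 : R) Z (field eps (Z t))) ->
    state_energy (Z b') <= state_energy (Z a').
  move=> epss aa ab bb Zc Zd.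
  apply: (@is_derive_nonincreasing R a' b' (fun t => state_energy (Z t))) => //.
  - by apply: (@comp_continuous _ _ _ Z state_energy) => //; exact: state_energy_continuous.
  - by move=> t /andP[t1 t2]; apply: is_derive_energy; apply: Zd;
      rewrite (le_lt_trans aa)// (lt_le_trans t2).
  move=> t _; have [] := rates eps (u_of (Z t)) (p_of (Z t)) (z_of (Z t)) epss.
  move=> + _; move=> /le_trans; apply.
  have : 0 <= beta / 2 * nsq (p_of (Z t)) by rewrite mulr_ge0 ?nsq_ge0// ltW// divr_gt0.
  by have := nsq_ge0 (zdev A B (u_of (Z t)) (z_of (Z t))); lra.
split.
  move=> eps a b Y epss; rewrite le_eqVlt => /predU1P[->//|ab] Yf.
  have [Z [Zc ZY Zd]] := flows_along_C1 ab Yf.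
  rewrite -(ZY b) ?lexx ?(ltW ab)// -(ZY a) ?lexx ?(ltW ab)//.
  by apply: (nonincr eps a b a b Z) => //; exact: ltW.
move=> h h0; pose C := C1 + C2.
have C0 : 0 <= C by rewrite addr_ge0// ltW.
have [k k01 contr] := interval_contraction beta0 m0 C0 h0.
exists k => // eps a b Y epss hab Yf.
have ab : a < b by lra.
have [Z [Zc ZY Zd]] := flows_along_C1 ab Yf.
rewrite -(ZY b) ?lexx ?(ltW ab)// -(ZY a) ?lexx ?(ltW ab)//.
apply: (@le_trans _ _ (k * state_energy (Z (b - h)))); last first.
  rewrite ler_wpM2l//; first by case/andP: k01 => /ltW.
  by apply: (nonincr eps a b a (b - h) Z) => //; lra.
have cZ (f : 'cV[R]_N -> R) : continuous f -> continuous (fun t => f (Z t)).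
  by move=> fc; exact: (@comp_continuous _ _ _ Z f).
have tab t : b - h < t < b -> a < t < b.
  by move=> /andP[t1 ->]; rewrite andbT; lra.
apply: (contr (b - h) b (fun t => state_energy (Z t))
  (fun t => dot (p_of (Z t)) (u_of (Z t) - ustar))
  (fun t => excess A B L d phi_u phi_y ustar (u_of (Z t)))
  (fun t => nsq (p_of (Z t))) (fun t => nsq (zdev A B (u_of (Z t)) (z_of (Z t))))
  (fun t => nsq (u_of (Z t) - ustar))
  (fun t => energy_rate beta A P B L d phi_u phi_y eps (u_of (Z t)) (p_of (Z t)) (z_of (Z t)))
  (fun t => cross_rate beta A B L d phi_u phi_y ustar (u_of (Z t)) (p_of (Z t)) (z_of (Z t)))).
- by lra.
- by apply: cZ; exact: state_energy_continuous.
- have h1 : continuous (fun t => p_of (Z t)).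
    by apply: (@comp_continuous _ _ _ Z _ Zc); exact: p_of_continuous.
  have h2 : continuous (fun t => u_of (Z t)).
    by apply: (@comp_continuous _ _ _ Z _ Zc); exact: u_of_continuous.
  move=> x; apply: continuous_sum_fun => i; apply: continuousM.
    by apply: (@comp_continuous _ _ _ _ (fun M : 'cV[R]_n => M i 0) h1); exact: coord_continuous.
  apply: (@comp_continuous _ _ _ (fun t => u_of (Z t) - ustar) (fun M : 'cV[R]_n => M i 0));
    last exact: coord_continuous.
  by apply: addv_continuous; [exact: h2|exact: cst_continuous].
- by move=> t /tab/Zd; exact: is_derive_energy.
- by move=> t /tab/Zd; exact: is_derive_cross.
- by move=> t; split; exact: nsq_ge0.
- move=> t c r c0; have := dot_young (p_of (Z t)) (r *: (u_of (Z t) - ustar)) c0.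
  by rewrite !dotZr !dotZl [r * (r * _)]mulrA -expr2.
- move=> t; have [_ [_ h2]] := bounds (u_of (Z t)) (p_of (Z t)) (z_of (Z t)).
  apply: le_trans h2 _; rewrite lerD2l ler_wpM2r ?nsq_ge0// /C; lra.
- by move=> t; have [] := rates eps (u_of (Z t)) (p_of (Z t)) (z_of (Z t)) epss; lra.
- move=> t; have [_ h2] := rates eps (u_of (Z t)) (p_of (Z t)) (z_of (Z t)) epss.
  apply: le_trans h2 _; rewrite lerD2r lerD2r.
  have q1 := nsq_ge0 (p_of (Z t)); have q2 := nsq_ge0 (zdev A B (u_of (Z t)) (z_of (Z t))).
  by rewrite lerD// ler_wpM2r// /C; lra.
Qed.

End flow.

(** * Hybrid time domains and counting low resets *)

Section hybrid.
Variable R : realType.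

(** What both forms of a hybrid time domain have in common: the intervals start at
    the jump times, are intervals, and are entered by a jump. *)
Lemma ht_domain_starts (E : set (R * nat)) : ht_domain E ->
  exists2 s : nat -> R, s 0%N = 0 & forall j t, E (t, j) ->
    [/\ s j <= t, forall r, s j <= r <= t -> E (r, j) &
        forall i, j = i.+1 -> E (s j, i)].
Proof.
move=> [s [s0 smono] [->|[k [c [sk ->]]]]]; exists s => // j t /=.
  move=> /andP[h1 h2]; split => //.
    by move=> r /andP[h3 h4]; rewrite h3 (le_trans h4).
  by move=> i ->; rewrite smono lexx.
move=> [[jk /andP[h1 h2]]|[-> tc]].
  split => //.
    by move=> r /andP[h3 h4]; left; rewrite h3 (le_trans h4).
  by move=> i ij; subst j; left; rewrite smono lexx ltnW.
have := tc; rewrite itv_boundlr => /andP[h1 h2]; split => //.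
  move=> r /andP[h3 h4]; right; split => //; rewrite itv_boundlr bnd_simp h3/=.
  by apply: le_trans h2; rewrite bnd_simp.
by move=> i ki; left; rewrite ki ltnSn smono lexx.
Qed.

(** The reset [v i] starts the flow with jump counter [i.+1]. *)
Definition low_resets (v : nat -> R) (Te : R) (k : nat) : nat :=
  (\sum_(0 <= i < k) (v i <= Te)%R)%N.

(** When the jump counter is [j], the flows with counters [1] to [j.-1] are complete.
    Each of them lasts [T - v i], where [v i] is the reset that started it, since
    jumps occur only at timer [T]; so the low resets among the first [j.-1] have
    each produced a contraction. *)
Lemma hybrid_decay N (E : set (R * nat)) (Y : R -> nat -> 'cV[R]_N)
    (V tau : 'cV[R]_N -> R) (v : nat -> R) (T Te kappa : R) :
  ht_domain E -> E (0, 0%N) -> 0 < kappa ->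
  (forall j, 0 <= v j <= T) -> 0 <= tau (Y 0 0%N) <= T ->
  (forall j a b, a <= b -> (forall t, a <= t <= b -> E (t, j)) ->
     [/\ tau (Y b j) = tau (Y a j) + (b - a),
         tau (Y a j) <= T -> tau (Y b j) <= T,
         V (Y b j) <= V (Y a j) &
         a + (T - Te) <= b -> V (Y b j) <= kappa * V (Y a j)]) ->
  (forall t j, E (t, j) -> E (t, j.+1) ->
     [/\ tau (Y t j) = T, tau (Y t j.+1) = v j & V (Y t j.+1) <= V (Y t j)]) ->
  forall t j, E (t, j) ->
    [/\ 0 <= tau (Y t j) <= T, t <= j.+1%:R * T &
        V (Y t j) <= kappa ^+ low_resets v Te j.-1 * V (Y 0 0%N)].
Proof.
move=> hE E0 k0 vT tau0 flow jump.
have [s s0 sE] := ht_domain_starts hE.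
have start j : E (s j, j) -> [/\ 0 <= tau (Y (s j) j) <= T, s j <= j%:R * T,
    V (Y (s j) j) <= kappa ^+ low_resets v Te j.-1 * V (Y 0 0%N) &
    forall i, j = i.+1 -> tau (Y (s j) j) = v i].
  elim: j => [|j IH] Ej; first by rewrite s0 mul0r lexx /low_resets big_geq// expr0 mul1r.
  have [_ _ /(_ j erefl) Ejj] := sE _ _ Ej.
  have [ss Eb _] := sE _ _ Ejj.
  have [|/andP[ta tb] sj Vj tauj] := IH; first by apply: Eb; rewrite lexx ss.
  have [tauE _ Vn Vc] := flow j (s j) (s j.+1) ss Eb.
  have [tauT tauv VJ] := jump _ _ Ejj Ej.
  split => //.
  - by rewrite tauv.
  - by rewrite -natr1 mulrDl mul1r; lra.
  - apply: le_trans VJ _; case: j IH Ej Ejj ss Eb sj Vj tauj tauE Vn Vc tauT tauv ta tb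
      => [|i] IH Ej Ejj ss Eb sj Vj tauj tauE Vn Vc tauT tauv ta tb /=.
      exact: le_trans Vn _.
    rewrite /low_resets big_nat_recr//= exprD.
    have [vi|vi] := leP (v i) Te; last by rewrite expr0 mulr1; exact: le_trans Vn _.
    rewrite expr1 mulrAC mulrC; apply: le_trans (Vc _) _.
      by move: tauE; rewrite tauT (tauj i erefl); lra.
    by rewrite ler_wpM2l// ltW.
  by move=> i [<-].
move=> t j Etj; have [st Eb _] := sE _ _ Etj.
have [|/andP[ta tb] sj Vj _] := start j; first by apply: Eb; rewrite lexx st.
have [tauE tauT Vn _] := flow j (s j) t st Eb.
have {}tauT := tauT tb.
split; first by rewrite tauT andbT tauE; lra.
- by rewrite -natr1 mulrDl mul1r; lra.
- exact: le_trans Vn _.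
Qed.

Lemma low_resets_mono (v : nat -> R) Te k l : (k <= l)%N -> (low_resets v Te k <= low_resets v Te l)%N.
Proof. by move=> kl; rewrite /low_resets [leqRHS](big_cat_nat (n := k))//= leq_addr. Qed.

Lemma low_resets_blocks (v : nat -> R) Te b M :
  (forall i, (i < M)%N -> exists2 j, j \in iota (i * b) b & v j <= Te) ->
  (M <= low_resets v Te (M * b))%N.
Proof.
elim: M => // M IH H.
have [|j] := H M; first exact: ltnSn.
rewrite mem_iota => /andP[j1 j2] vj.
have h : (M <= low_resets v Te (M * b))%N by apply: IH => i iM; apply: H; exact: ltnW.
rewrite mulSnr /low_resets (big_cat_nat (n := M * b)) ?leq_addr//= -addn1 leq_add//.
rewrite (big_cat_nat (n := j)) ?(ltnW j2)//= [X in (_ + X)%N]big_ltn// vj.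
by rewrite addnCA leq_addr.
Qed.

End hybrid.

Lemma small_power (R : realType) (q r : R) : 0 <= q < 1 -> 0 < r ->
  exists k : nat, q ^+ k < r.
Proof.
move=> /andP[q0 q1] r0.
have : (fun k => q ^+ k) @ \oo --> (0 : R) by apply: cvg_expr; rewrite ger0_norm.
move=> /cvgrPdist_lt /(_ r r0) [k _ /(_ k (leqnn k))] /=.
by rewrite sub0r normrN ger0_norm ?exprn_ge0//; exists k.
Qed.

Section probability.
Variables (R : realType) (N : nat) (S : shs R N).
Variables (d : measure_display) (Omega : measurableType d) (P : probability Omega R).
Variable v : nat -> {RV P >-> measurableTypeR R}.
Hypothesis iid : iid_input S v.

Lemma preimage_law j (B : set (measurableTypeR R)) : measurable B ->
  P (v j @^-1` B) = input_law S B.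
Proof. by move=> mB; rewrite -(iid.1 j B mB). Qed.

Lemma measurable_preimage j (B : set (measurableTypeR R)) : measurable B ->
  measurable (v j @^-1` B).
Proof. by move=> mB; rewrite -[X in measurable X]setTI; exact: measurable_funPT. Qed.

(** The resets are cut into [M] blocks of length [b]. By independence a block
    misses [[0, Te]] with probability [(1 - p) ^+ b], and the union bound applies
    to the blocks. *)
Lemma many_low_resets (T Te : R) (M : nat) (r : R) :
  input_law S `[0, T]%classic = 1%E -> (0 < input_law S `[0%R, Te]%classic)%E -> 0 < r ->
  exists J : nat, exists Bad : set Omega,
    [/\ measurable Bad, (P Bad <= r%:E)%E &
      forall w, ~ Bad w -> (forall j, 0 <= v j w <= T) /\
        (M <= low_resets (fun j => v j w) Te J)%N].
Proof.
move=> muT muTe r0.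
pose p := fine (input_law S `[0, Te]%classic).
have pE : input_law S `[0, Te]%classic = p%:E.
  by rewrite /p fineK// fin_num_measure.
have p0 : 0 < p by rewrite -lte_fin -pE.
have p1 : p <= 1 by rewrite -lee_fin -pE probability_le1.
(* The failure probability of one block must be at most [r / M]; [M + 1] allows
   [M = 0]. *)
have [b qb] : exists b : nat, (1 - p) ^+ b < r / (M%:R + 1).
  by apply: small_power; [lra|rewrite divr_gt0// ltr_wpDl].
pose out j := v j @^-1` (~` `[0, T]%classic : set (measurableTypeR R)).
have mout j : measurable (out j) by apply: measurable_preimage; exact: measurableC.
have out0 j : P (out j) = 0.
  rewrite /out preimage_law; last exact: measurableC.
  by rewrite probability_setC// muT subee.
pose miss i := \big[setI/setT]_(j <- iota (i * b) b)
  (v j @^-1` (~` `[0, Te]%classic : set (measurableTypeR R))).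
have mmiss i : measurable (miss i).
  apply: bigsetI_measurable => j _; apply: measurable_preimage; exact: measurableC.
have Pmiss i : P (miss i) = ((1 - p) ^+ b)%:E.
  rewrite /miss (iid.2 _ (fun=> ~` `[0, Te]%classic)) ?iota_uniq//; last first.
    by move=> j; exact: measurableC.
  rewrite (eq_bigr (fun=> (1 - p)%:E)); last first.
    move=> j _; rewrite preimage_law; last exact: measurableC.
    by rewrite probability_setC// pE -EFinD.
  by rewrite prodEFin big_const_seq count_predT size_iota -Monoid.iteropE -/(_ ^+ b).
exists (M * b)%N, (\bigcup_j out j `|` \big[setU/set0]_(i < M) miss i).
have mo : measurable (\bigcup_j out j) by exact: bigcupT_measurable.
have mm : measurable (\big[setU/set0]_(i < M) miss i).
  by apply: bigsetU_measurable => i _.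
split; first exact: measurableU.
  apply: le_trans (measureU2 _ mo mm) _.
  rewrite [X in (X + _ <= _)%E](_ : _ = 0%E); last first.
    apply: measure_negligible => //.
    by apply: negligible_bigcup => j; exists (out j); split; [exact: mout|exact: out0|].
  rewrite add0e; apply: le_trans (Boole_inequality _ _) _ => //.
  rewrite (eq_bigr (fun=> ((1 - p) ^+ b)%:E)); last by move=> i _; exact: Pmiss.
  rewrite sumEFin lee_fin sumr_const card_ord -mulr_natr.
  move: qb; rewrite ltr_pdivlMr; last by rewrite ltr_wpDl.
  have : 0 <= (1 - p) ^+ b by apply: exprn_ge0; lra.
  by lra.
move=> w /not_orP[now nmiss]; split.
  move=> j; apply: contrapT => h; apply: now; exists j => //.
apply: low_resets_blocks => i iM; apply: contrapT => h; apply: nmiss.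
rewrite -bigcup_mkord /=.
exists i => //.
rewrite /miss -bigcap_seq => j /= jb /=.
by rewrite in_itv/= => /andP[_ vj]; apply: h; exists j.
Qed.

Lemma stays_within_prob (y : Omega -> arc R N) A e T r (Bad : set Omega) :
  stochastic_hybrid_arc y -> measurable Bad -> (P Bad <= r%:E)%E ->
  (forall w, ~ Bad w -> stays_within A e T y w) ->
  ((1 - r)%:E <= P (stays_within A e T y))%E.
Proof.
move=> ys mB PB good.
apply: (@le_trans _ _ (P (~` Bad))).
  rewrite probability_setC// EFinB.
  by rewrite leeB.
apply: le_measure; rewrite ?inE//; first exact: measurableC.
exact: stays_within_measurable.
Qed.

End probability.

(** * Stability in probability *)

Section stability.
Variables (R : realType) (n n2 p0 : nat) (T Te beta rho m Lphi Lphiy : R).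
Variables (A Q : 'M[R]_n2) (B : 'M[R]_(n2, n)) (L : 'M[R]_(p0, n2)) (d : 'cV[R]_p0).
Variables (phi_u : 'cV[R]_n -> R) (phi_y : 'cV[R]_p0 -> R) (ustar : 'cV[R]_n).
Variable mu : probability (measurableTypeR R) R.
Let phi := fun u : 'cV[R]_n => phi_u u + phi_y (Hss A B L *m u + d).
Let N := (n + n + 1 + n2)%N.

Hypotheses (T0 : 0 < T) (TeT : 0 <= Te < T) (rho01 : 0 <= rho < 1).
Hypotheses (beta0 : 0 < beta) (m0 : 0 < m) (Lphi0 : 0 < Lphi) (Lphiy0 : 0 < Lphiy).
Hypotheses (phi_uC : continuously_differentiable phi_u)
  (phi_yC : continuously_differentiable phi_y).
Hypotheses (Qpos : posdef Q) (Lyap : negdef (A^T *m Q + Q *m A)).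
Hypotheses (phi_smooth : smooth Lphi phi) (phi_cvx : strongly_convex m phi)
  (phi_y_smooth : smooth Lphiy phi_y) (ustar_min : unique_minimizer phi ustar).

Notation system := (tuned_system T beta rho A B L d phi_u phi_y mu).
Notation dist2 := (target_dist2 (invmx A *m B) ustar).

(** A jump multiplies [p] by [s <= rho < 1] and keeps [u] and [z]. *)
Lemma jump_energy (y y' : 'cV[R]_N) v eps : jump_map (system eps) y v y' ->
  tau_of y' = v /\
  state_energy A Q B L d phi_u phi_y ustar y' <= state_energy A Q B L d phi_u phi_y ustar y.
Proof.
move=> [s]; rewrite /= in_itv/= => /andP[s0 srho] <-; rewrite /state_energy !stackK; split => //.
rewrite /energy lerD2r lerD2l ler_pM2r ?invr_gt0// dotZl dotZr mulrA.
rewrite -[leRHS]mul1r ler_wpM2r ?nsq_ge0//.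
have s1 : s <= 1 by case/andP: rho01; lra.
by rewrite -[leRHS]mulr1 ler_pM.
Qed.

Lemma solution_decay : exists2 epsstar : R, 0 < epsstar &
  exists2 C : R, 0 < C & exists2 kappa : R, 0 < kappa < 1 &
  forall eps, 0 < eps < epsstar ->
  forall (dd : measure_display) (Omega : measurableType dd) (P : probability Omega R)
    (v : nat -> {RV P >-> measurableTypeR R}) (y0 : 'cV[R]_N) y,
  0 <= tau_of y0 <= T -> random_solution (system eps) v y0 y ->
  forall w, (forall j, 0 <= v j w <= T) -> forall t j, hdom (y w) (t, j) ->
    [/\ 0 <= tau_of (hval (y w) t j) <= T, t <= j.+1%:R * T &
      dist2 (hval (y w) t j) <=
        C ^+ 2 * kappa ^+ low_resets (fun j => v j w) Te j.-1 * dist2 y0].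
Proof.
have [es es0 [nonincr contr]] := flow_decay T rho mu beta0 m0 Lphi0 Lphiy0 phi_uC phi_yC
  Qpos Lyap phi_smooth phi_cvx phi_y_smooth ustar_min.
have h0 : 0 < T - Te by case/andP: TeT; lra.
have [k k01 {}contr] := contr _ h0.
have [C C0 bounds] := energy_bounds m0 Lphi0 Qpos phi_smooth phi_cvx ustar_min.
exists es => //; exists C => //; exists k => // eps epss dd Omega P v y0 y tau0.
move=> [[hyb _] [_ sol]] w vT t j Etj.
have [[E0 Y0] flow jump] := sol w.
have [dom ac] := hyb w.
pose V := state_energy A Q B L d phi_u phi_y ustar.
have [] := @hybrid_decay R N (hdom (y w)) (hval (y w)) V (@tau_of R n n2)
  (fun j => v j w) T Te k dom E0 (andP k01).1 vT _ _ _ t j Etj.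
- by rewrite Y0.
- move=> i a b ab Eab.
  have fa : flows_along T beta rho A B L d phi_u phi_y mu eps a b (hval (y w) ^~ i).
    split; first by apply: ac => //; apply: Eab; rewrite lexx ab.
    by move=> ab'; apply: flow => //; apply: Eab; rewrite lexx ab.
  split.
  - exact: (flows_along_tau phi_uC phi_yC ab fa).
  - exact: (flows_along_tau_le phi_uC phi_yC ab fa).
  - exact: nonincr fa.
  - by move=> hab; exact: contr fa.
- move=> s i Ei Ei1; have [js jm] := jump s i Ei Ei1.
  by have [jt jV] := jump_energy jm.
move=> tauT tT Vt; split => //.
have [b1 _] := bounds (u_of (hval (y w) t j)) (p_of (hval (y w) t j)) (z_of (hval (y w) t j)).
have [_ [b2 _]] := bounds (u_of y0) (p_of y0) (z_of y0).
apply: le_trans b1 _; rewrite expr2 -!mulrA ler_pM2l//.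
apply: le_trans Vt _; rewrite mulrCA ler_wpM2l ?exprn_ge0 ?(ltW (andP k01).1)//.
by rewrite Y0.
Qed.

Lemma target_dist2_ge0 (y : 'cV[R]_N) : 0 <= dist2 y.
Proof. by rewrite /target_dist2 !addr_ge0// nsq_ge0. Qed.

Lemma initial_tau eps r (y0 : 'cV[R]_N) :
  initial_within (system eps) (target_set T A B ustar) r y0 -> 0 <= tau_of y0 <= T.
Proof. by move=> [[//|/= ->] _]; rewrite ltW//= lexx. Qed.

Lemma stability : mu `[0, T]%classic = 1%E -> (0 < mu `[0%R, Te]%classic)%E ->
  exists2 epsstar : R, 0 < epsstar & forall eps : R, 0 < eps < epsstar ->
    ugasp (system eps) (target_set T A B ustar).
Proof.
move=> muT muTe.
have [es es0 [C C0 [k k01 decay]]] := solution_decay.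
have [k0 k1] := andP k01.
exists es => // eps epss dd Omega P v iid.
(* For [M = 0] the estimate holds at all times. Otherwise it needs [J] resets that
   have taken effect: as [t <= j.+1%:R * T], hybrid times beyond [(J + 2) (T + 1)]
   have [J + 1 <= j], and the last reset starts the current flow. *)
have main e r delta M J Bad (Tbar : R) y0 y : 0 < e -> 0 < delta ->
    measurable Bad -> (P Bad <= r%:E)%E ->
    (forall w, ~ Bad w -> (forall j, 0 <= v j w <= T) /\
       (M <= low_resets (fun j => v j w) Te J)%N) ->
    C ^+ 2 * k ^+ M * (2 * delta) ^+ 2 < e ^+ 2 ->
    M = 0%N \/ (J.+2%:R * (T + 1) <= Tbar) ->
    initial_within (system eps) (target_set T A B ustar) delta y0 ->
    random_solution (system eps) v y0 y ->
    ((1 - r)%:E <= P (stays_within (target_set T A B ustar) e Tbar y))%E.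
  move=> e0 delta0 mBad PBad good small late y0i sol.
  apply: (stays_within_prob sol.1 mBad PBad) => w /good[vT Mh] t j Etj Tt.
  have [tauT tT dt] := decay eps epss _ _ _ _ _ _ (initial_tau y0i) sol w vT t j Etj.
  apply: target_eball => //; apply: le_lt_trans dt _; apply: le_lt_trans small.
  apply: ler_pM.
  - by rewrite mulr_ge0 ?exprn_ge0// ltW.
  - exact: target_dist2_ge0.
  - rewrite ler_wpM2l ?exprn_ge0 ?(ltW C0)//.
    rewrite ler_wiXn2l ?(ltW k0) ?(ltW k1)//.
    case: late => [->//|late]; apply: leq_trans Mh _; apply: low_resets_mono.
    rewrite -(leq_add2r 2) !addn2; suff : (J.+2 <= j.+1)%N by case: (j).
    rewrite -(ler_nat R) -(ler_pM2r (_ : 0 < T + 1)); last by lra.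
    apply: le_trans late _; apply: le_trans Tt _.
    by rewrite mulrDr mulr1 lerD// ler_nat.
  - by apply: target_edist y0i.2 => //; exact: ltW.
have [muT' muTe'] : input_law (system eps) `[0, T]%classic = 1%E /\
    (0 < input_law (system eps) `[0%R, Te]%classic)%E by [].
split.
(* The squared distance grows at most by the factor [C ^+ 2], and the bound on
   [edist] is read up to a factor [2]. *)
- move=> e r e0 r0.
  have d0 : 0 < e / (4 * C) by rewrite divr_gt0// mulr_gt0.
  exists (e / (4 * C)) => // y0 y y0i [sol _].
  have [J [Bad [mBad PBad good]]] := many_low_resets iid 0 muT' muTe' r0.
  apply: (main _ _ _ _ _ _ _ _ _ e0 d0 mBad PBad good _ (or_introl erefl) y0i sol).
  rewrite expr0 mulr1 -exprMn.
  have -> : C * (2 * (e / (4 * C))) = e / 2 by field; rewrite gt_eqF.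
  have e2 : 0 < e / 2 by rewrite divr_gt0.
  by rewrite ltr_pXn2r ?nnegrE ?(ltW e0) ?(ltW e2)//; lra.
- move=> delta r d0 r0.
  have e0 : 0 < 2 * C * delta + 1.
    have : 0 < C * delta by rewrite mulr_gt0.
    lra.
  exists (2 * C * delta + 1) => // y0 y y0i [sol _].
  have [J [Bad [mBad PBad good]]] := many_low_resets iid 0 muT' muTe' r0.
  apply: (main _ _ _ _ _ _ _ _ _ e0 d0 mBad PBad good _ (or_introl erefl) y0i sol).
  have Cd : 0 < C * (2 * delta) by rewrite !mulr_gt0.
  by rewrite expr0 mulr1 -exprMn ltr_pXn2r ?nnegrE ?(ltW e0) ?(ltW Cd)//; lra.
move=> e r rad e0 r0 rad0.
have [M kM] : exists M : nat, k ^+ M < e ^+ 2 / (C ^+ 2 * (2 * rad) ^+ 2).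
  apply: small_power; first by rewrite k1 ltW.
  by rewrite divr_gt0 ?mulr_gt0 ?exprn_gt0// mulr_gt0.
have [J [Bad [mBad PBad good]]] := many_low_resets iid M muT' muTe' r0.
exists (J.+2%:R * (T + 1)); first by apply: mulr_ge0; [exact: ler0n|exact: (addr_ge0 (ltW T0) ler01)].
move=> y0 y y0i sol.
apply: (main _ _ _ _ _ _ _ _ _ e0 rad0 mBad PBad good _ (or_intror (lexx _)) y0i sol).
rewrite mulrAC mulrC -ltr_pdivlMr// ?mulr_gt0 ?exprn_gt0// mulr_gt0//.
Qed.

End stability.

Theorem proposition2 (R : realType) (n n2 p0 : nat) (T beta rho : R)
  (A : 'M[R]_n2) (B : 'M[R]_(n2, n)) (L : 'M[R]_(p0, n2)) (d : 'cV[R]_p0)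
  (K : 'M[R]_(n, p0)) (phi_u : 'cV[R]_n -> R) (phi_y : 'cV[R]_p0 -> R)
  (mu : probability (measurableTypeR R) R) :
  0 < T -> 0 < beta -> 0 <= rho < 1 ->
  continuously_differentiable phi_u -> continuously_differentiable phi_y ->
  mu `[0, T]%classic = 1%E ->
  (exists P : 'M[R]_n2, posdef P /\ negdef (A^T *m P + P *m A)) ->
  let H := Hss A B L in
  let phi := fun u : 'cV[R]_n => phi_u u + phi_y (H *m u + d) in
  (exists m_phi L_phi L_phi_y : R,
    [/\ 0 < m_phi, 0 < L_phi & 0 < L_phi_y] /\
    [/\ smooth L_phi phi, strongly_convex m_phi phi & smooth L_phi_y phi_y]) ->
  (exists2 Te : R, 0 <= Te < T & (0 < mu `[0%R, Te]%classic)%E) ->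
  K = H^T ->
  exists ustar : 'cV[R]_n, unique_minimizer phi ustar /\
    exists2 epsstar : R, 0 < epsstar &
      forall eps : R, 0 < eps < epsstar ->
        ugasp (Hsys T beta rho A B L d K phi_u phi_y mu eps)
              (target_set T A B ustar).
Proof.
move=> T0 beta0 rho01 phi_uC phi_yC muT [Q [Qpos Lyap]] H phi.
move=> [m [Lphi [Lphiy [[m0 Lphi0 Lphiy0] [phiS phiC phiyS]]]]] [Te TeT muTe] ->.
have [ustar ustar_min] := strongly_convex_minimizer m0 phiS.1 phiC.
exists ustar; split => //.
exact: (stability T0 TeT rho01 beta0 m0 Lphi0 Lphiy0 phi_uC phi_yC Qpos Lyap
  phiS phiC phiyS ustar_min muT muTe).
Qed.
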